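(* Let $(X,\mathcal B,p)$ be a standard Lebesgue probability space, let $\mathcal T$ be the space of all maps of $(X,\mathcal B,p)$ with the weak topology, and let $1\le r\le\infty$. Then the generic pair of maps $(\sigma,\tau)\in\mathcal T\times\mathcal T$ has no non-trivial common coboundary with transfer functions in $L_r^0(X)$. That is, there is a dense $G_\delta$ set $\mathcal E\subset\mathcal T\times\mathcal T$ such that for every $(\sigma,\tau)\in\mathcal E$: if $h,g\in L_r^0(X)$ satisfy $h-h\circ\tau=g-g\circ\sigma$, then $h-h\circ\tau=0$.
   Context: A standard Lebesgue probability space is one isomorphic (mod null sets) to $[0,1)$ with Lebesgue measure. A map of $(X,\mathcal B,p)$ is an invertible measure-preserving transformation $\tau:X\to X$; maps agreeing a.e. are identified. The weak topology on the set $\mathcal T$ of all maps is the topology in which $\tau_s\to\tau$ if and only if $p(\tau_s A\,\triangle\,\tau A)\to 0$ for every $A\in\mathcal B$; $\mathcal T\times\mathcal T$ has the product topology. $L_r^0(X)$ denotes the mean-zero functions in $L_r(X)$. A function $f$ is a $\tau$-coboundary with transfer function $h$ if $f=h-h\circ\tau$ a.e. A common coboundary for $\sigma$ and $\tau$ is a function that is both a $\sigma$-coboundary and a $\tau$-coboundary; it is non-trivial if it is not a.e. zero. A property is generic if it holds on a set containing a dense $G_\delta$ set. *)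

(* Defs.v *)
From HB Require Import structures.
From mathcomp Require Import all_boot all_order all_algebra.
From mathcomp Require Import all_classical all_reals all_analysis.

Set Implicit Arguments.
Unset Strict Implicit.
Unset Printing Implicit Defensive.

Import Order.TTheory GRing.Theory Num.Theory.
Import numFieldNormedType.Exports.

Local Open Scope classical_set_scope.
Local Open Scope ring_scope.

(* [phi] is an isomorphism, between conull measurable subsets, of the space of
   [mu] onto the restriction of the space of [nu] to [D]. *)
Definition iso_mod_null d1 d2 (T : measurableType d1) (U : measurableType d2)
    (R : realType) (mu : set T -> \bar R) (nu : set U -> \bar R) (D : set U) :=
  exists (T0 : set T) (U0 : set U) (phi : T -> U),
    [/\ measurable T0 /\ mu (~` T0) = 0%E,
        [/\ measurable U0, U0 `<=` D & nu (D `\` U0) = 0%E],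
        set_bij T0 U0 phi,
        (forall B, measurable B -> B `<=` U0 ->
           measurable (T0 `&` phi @^-1` B) /\ mu (T0 `&` phi @^-1` B) = nu B) &
        (forall A, measurable A -> A `<=` T0 -> measurable (phi @` A))].

(* Lebesgue measure on [0, 1) may be taken either on the Borel sets or on the
   Lebesgue measurable sets; both conventions are admitted. *)
Definition standard_lebesgue d (T : measurableType d) (R : realType)
    (P : probability T R) :=
  iso_mod_null P (@lebesgue_measure R) [set x : R | 0 <= x < 1] \/
  iso_mod_null P (@completed_lebesgue_measure R) [set x : R | 0 <= x < 1].

Section maps.
Context d (T : measurableType d) (R : realType) (P : probability T R).

Definition invertible_measure_preserving (f : T -> T) :=
  [/\ measurable_fun setT f,
      (forall A, measurable A -> P (f @^-1` A) = P A) &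
      exists g, [/\ cancel f g, cancel g f & measurable_fun setT g]].

Record imp_map := ImpMap {
  imp_fun :> T -> T;
  imp_funP : invertible_measure_preserving imp_fun }.

HB.instance Definition _ := gen_eqMixin imp_map.
HB.instance Definition _ := gen_choiceMixin imp_map.

Definition ae_eq_map (f g : imp_map) := `[< \forall x \ae P, f x = g x >].

Let ae_eq_map_refl : reflexive ae_eq_map.
Proof. by move=> f; apply/asboolP; exact: aeW. Qed.

Let ae_eq_map_sym : symmetric ae_eq_map.
Proof.
by move=> f g; apply/idP/idP => /asboolP h; apply/asboolP;
  apply: filterS h => x ->.
Qed.

Let ae_eq_map_trans : transitive ae_eq_map.
Proof.
by move=> f g h /asboolP gf /asboolP fh; apply/asboolP; apply: filterS2 gf fh
  => x -> ->.
Qed.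

Canonical ae_eq_map_equiv :=
  EquivRel ae_eq_map ae_eq_map_refl ae_eq_map_sym ae_eq_map_trans.

Local Open Scope quotient_scope.

Definition maps : Type := {eq_quot ae_eq_map}.
HB.instance Definition _ := Choice.on maps.
HB.instance Definition _ := EqQuotient.on maps.

(* The value at a point is that of a representative of the class, hence only
   meaningful up to a null set of points. *)
Definition fun_of_maps (tau : maps) : T -> T := repr tau.
Coercion fun_of_maps : maps >-> Funclass.

Lemma fun_of_mapsE (f : imp_map) : \forall x \ae P, (\pi_maps f : maps) x = f x.
Proof. by apply/asboolP; have /eqmodP := reprK (\pi_maps f). Qed.

Lemma maps_eqP (sigma tau : maps) :
  sigma = tau <-> \forall x \ae P, sigma x = tau x.
Proof.
split=> [->|h]; first exact: aeW.
by rewrite -[sigma]reprK -[tau]reprK; apply/eqmodP/asboolP.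
Qed.

Definition weak_dist (A : set T) (sigma tau : maps) : \bar R :=
  P ((sigma @` A) `+` (tau @` A)).

Definition weak_ball (s : seq (set T)) (e : R) (tau : maps) : set maps :=
  [set sigma | forall A, A \in s -> (weak_dist A sigma tau < e%:E)%E].

Definition weak_open : set (set maps) :=
  [set U | forall tau, U tau -> exists (s : seq (set T)) (e : R),
    [/\ forall A, A \in s -> measurable A, 0 < e & weak_ball s e tau `<=` U]].

Let weak_openT : weak_open setT.
Proof. by move=> tau _; exists [::], 1; split. Qed.

Let weak_openI : setI_closed weak_open.
Proof.
move=> U V oU oV tau [/oU[s [e [ms e0 sU]]] /oV[t [r [mt r0 tV]]]].
exists (s ++ t), (Num.min e r); split.
- by move=> A; rewrite mem_cat => /orP[/ms|/mt].
- by rewrite lt_min e0.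
- move=> sigma h; split; [apply: sU|apply: tV] => A sA;
    (apply: lt_le_trans (h A _) _; first by rewrite mem_cat sA ?orbT);
    by rewrite lee_fin ge_min lexx ?orbT.
Qed.

Let weak_open_bigU (I : Type) (f : I -> set maps) :
  (forall i, weak_open (f i)) -> weak_open (\bigcup_i f i).
Proof.
move=> of_ tau [i _ fit]; have [s [e [ms e0 sf]]] := of_ i tau fit.
by exists s, e; split => // sigma /sf ?; exists i.
Qed.

HB.instance Definition _ :=
  isOpenTopological.Build maps weak_openT weak_openI weak_open_bigU.

Lemma weak_openE : @open maps = weak_open.
Proof.
rewrite openE; apply/seteqP; split=> U oU tau Utau; last first.
  exact: (ex_intro _ U (And3 oU Utau (@subset_refl _ U))).
have [V [oV Vtau VU]] := oU _ Utau.
have [s [e [ms e0 sV]]] := oV _ Vtau.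
by exists s, e; split => //; exact: subset_trans VU.
Qed.

Lemma measurable_maps_image (tau : maps) A :
  measurable A -> measurable (tau @` A).
Proof.
move=> mA; rewrite /fun_of_maps; have [_ _ [g [fg gf mg]]] := imp_funP (repr tau).
have -> : repr tau @` A = g @^-1` A.
  apply/seteqP; split=> [_ [x Ax <-]|y Agy] /=; first by rewrite fg.
  by exists (g y).
by rewrite -[_ @^-1` _]setTI; exact: mg.
Qed.

Lemma weak_dist_fin_num A sigma tau : measurable A ->
  weak_dist A sigma tau \is a fin_num.
Proof.
move=> mA; apply: fin_num_measure; apply: measurableU; apply: measurableD;
exact: measurable_maps_image.
Qed.

Lemma weak_dist_triangle A sigma tau rho : measurable A ->
  (weak_dist A sigma rho <= weak_dist A sigma tau + weak_dist A tau rho)%E.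
Proof.
move=> mA; rewrite /weak_dist.
have mY (u v : maps) : measurable ((u @` A) `+` (v @` A)).
  by apply: measurableU; apply: measurableD; exact: measurable_maps_image.
apply: le_trans (measureU2 P (mY sigma tau) (mY tau rho)).
apply: le_measure; rewrite ?inE; [exact: mY|exact: measurableU|].
move=> x; rewrite /setY/=.
by have [?|?] := pselect ((tau @` A) x); tauto.
Qed.

Lemma weak_dist_refl A tau : weak_dist A tau tau = 0%E.
Proof. by rewrite /weak_dist setYK measure0. Qed.

Lemma open_weak_ball A (e : R) tau : measurable A ->
  open [set sigma : maps | (weak_dist A sigma tau < e%:E)%E].
Proof.
move=> mA; rewrite weak_openE => sigma /= dst.
have fd u v := @weak_dist_fin_num A u v mA.
exists [:: A], (e - fine (weak_dist A sigma tau)); split.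
- by move=> B; rewrite inE => /eqP ->.
- by rewrite subr_gt0 -lte_fin fineK.
- move=> rho /(_ A); rewrite inE eqxx => /(_ isT) h /=.
  apply: le_lt_trans (weak_dist_triangle rho sigma tau mA) _.
  by rewrite -lteBrDr// EFinB fineK// in h *.
Qed.

(* The topology of [maps] is determined by its convergent filters. *)
Lemma weak_cvgP (F : set_system maps) (tau : maps) : Filter F ->
  F --> tau <-> forall A, measurable A ->
    weak_dist A sigma tau @[sigma --> F] --> 0%E.
Proof.
move=> FF; split.
- move=> Ftau A mA; apply/fine_cvgP.
  have near_lt (e : R) : 0 < e -> \forall sigma \near F,
      (weak_dist A sigma tau < e%:E)%E.
    move=> e0; apply: Ftau; apply: open_nbhs_nbhs; split.
      exact: open_weak_ball.
    by rewrite /= weak_dist_refl lte_fin.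
  split; first by near=> sigma; exact: weak_dist_fin_num sigma tau mA.
  apply/cvgrPdist_lt => e e0; near=> sigma.
  rewrite sub0r normrN ger0_norm ?fine_ge0 ?measure_ge0//.
  rewrite -lte_fin fineK; last exact: weak_dist_fin_num sigma tau mA.
  by near: sigma; exact: near_lt.
- move=> h U; rewrite nbhsE => -[V [oV Vtau] VU].
  rewrite weak_openE in oV.
  have [s [e [ms e0 sV]]] := oV _ Vtau.
  apply: filterS VU _; apply: filterS sV _.
  elim: s ms => [|A s IH] ms.
    by apply: filterE => sigma A; rewrite in_nil.
  have hA := h A (ms A (mem_head _ _)).
  have hs : F (weak_ball s e tau).
    by apply: IH => B sB; apply: ms; rewrite inE sB orbT.
  have lt0 : \forall sigma \near F, (weak_dist A sigma tau < e%:E)%E.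
    exact: (hA _ (@nbhs_open_ereal_lt R 0 (fun=> e) e0)).
  by apply: filterS2 hs lt0 => sigma hs hA' B; rewrite inE => /orP[/eqP->//|/hs].
Unshelve. all: by end_near. Qed.

Definition Lr0 (r : \bar R) (h : T -> R) := h \in Lfun P r /\ 'E_P[h]%E = 0%E.

End maps.

(* Main.v *)
(* Write f = h - h o tau = g - g o sigma; it is enough to make f orthogonal to the
   indicator w of every dyadic cell.  If y is a bounded integer-valued function that
   is invariant under tau while y + w is invariant under sigma, then int f y = 0
   (transfer function h) and int f (y + w) = 0 (transfer function g), hence
   int f w = 0.  Such a y exists only off a small set Z and may be huge; capping it
   by the number of steps needed to reach Z makes its increments along orbits at
   most 1, so the two integrals are bounded by integrals of |h o tau| and
   |g o sigma| over a neighbourhood of Z, which suffices even for r = 1.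
   That approximate y exist is an open condition.  It is dense: every pair is
   weakly close to a pair (s, t) of permutations of dyadic cells, and on
   cells x [0, 2^k) one takes y(a, j) = j, keeps t, and lets s shift j by
   w(a) - w(s a); this moves (s, t) by only O(2^-k).  The Baire argument is run by
   hand: successively refined finite models converge, digit by digit, to a pair of
   genuine invertible maps. *)

Require Import Defs.
From mathcomp Require Import all_boot all_order all_algebra perm.
From mathcomp Require Import all_classical all_reals all_analysis borel_hierarchy.
From mathcomp Require Import measurable_realfun zify ring lra.

Set Implicit Arguments.
Unset Strict Implicit.
Unset Printing Implicit Defensive.

Import Order.TTheory GRing.Theory Num.Theory.
Import numFieldNormedType.Exports.

Local Open Scope classical_set_scope.
Local Open Scope ring_scope.

(** When [tau] is ergodic an invariant [y] is constant, so the relations between [y] and [w] cannot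
    hold exactly. They are exact in a finite model of some level [N], which the pair of maps follows
    off a small error set. The obstacle is that [y] may be as large as 2^N: capping spreads the
    error set over 2^N + 1 orbit steps, each multiplying its measure by at most 5, so the admissible
    error is doubly exponentially small in [N]. This is affordable because [N] is fixed before the
    later refinements; their fibres are then taken so long that all later changes together stay
    within the tolerance of every earlier level. The integral of an integrable function over a small
    set has no rate in the measure of the set, so a whole sequence of models with summable error
    sets is used. A digitwise limit of permutations need not be invertible. Here the inverse
    permutations converge as fast as the permutations, and their limit supplies the inverse. The
    underlying space enters only through [dyadic_coding], which covers the Borel and the Lebesgue
    convention alike. *)

(** * Probabilities as real numbers *)

Section real_probability.
Context d (T : measurableType d) (R : realType) (P : probability T R).
Implicit Types A B C : set T.

Definition prb A : R := fine (P A).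

Lemma prbE A : measurable A -> P A = (prb A)%:E.
Proof. by move=> mA; rewrite fineK// fin_num_measure. Qed.

Lemma prb_ge0 A : 0 <= prb A.
Proof. by rewrite fine_ge0. Qed.

Lemma prb_le A B : measurable A -> measurable B -> A `<=` B -> prb A <= prb B.
Proof.
by move=> mA mB AB; rewrite -lee_fin -!prbE//; apply: le_measure; rewrite ?inE.
Qed.

Lemma prbU A B : measurable A -> measurable B -> prb (A `|` B) <= prb A + prb B.
Proof.
move=> mA mB; rewrite -lee_fin EFinD -!prbE//; last exact: measurableU.
exact: measureU2.
Qed.

Lemma prb_leU A B C : measurable A -> measurable B -> measurable C ->
  A `<=` B `|` C -> prb A <= prb B + prb C.
Proof.
move=> mA mB mC ABC; apply: le_trans (prbU mB mC).
by apply: prb_le => //; exact: measurableU.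
Qed.

Lemma prb0 : prb set0 = 0.
Proof. by rewrite /prb measure0. Qed.

Lemma prbC A : measurable A -> prb (~` A) = 1 - prb A.
Proof. by move=> mA; rewrite /prb probability_setC// prbE. Qed.

Lemma prb_disjointU A B : measurable A -> measurable B -> A `&` B = set0 ->
  prb (A `|` B) = prb A + prb B.
Proof.
move=> mA mB AB; apply: EFin_inj; rewrite EFinD -!prbE//; last exact: measurableU.
by rewrite measureU.
Qed.

Lemma prb_split A B : measurable A -> measurable B ->
  prb A = prb (A `&` B) + prb (A `\` B).
Proof.
move=> mA mB; rewrite -prb_disjointU.
- by rewrite -setIUr setUCr setIT.
- exact: measurableI.
- exact: measurableD.
- by rewrite setDE setIACA setIid setICr setI0.
Qed.

Lemma prb_bigU (I : Type) (r : seq I) (F : I -> set T) :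
  (forall i, measurable (F i)) ->
  prb (\big[setU/set0]_(i <- r) F i) <= \sum_(i <- r) prb (F i).
Proof.
move=> mF; have mU s : measurable (\big[setU/set0]_(i <- s) F i).
  by apply: bigsetU_measurable.
elim: r => [|i r IH]; first by rewrite !big_nil prb0.
rewrite !big_cons; apply: le_trans (prbU (mF i) (mU r)) _.
by rewrite lerD2l.
Qed.

Lemma prb_bigcup_geo (F : (set T)^nat) (a : R) : 0 <= a ->
  (forall k, measurable (F k)) -> (forall k, prb (F k) <= a / (2 ^ k.+1)%:R) ->
  prb (\bigcup_k F k) <= a.
Proof.
move=> a0 mF Fa; have mU : measurable (\bigcup_k F k) by exact: bigcupT_measurable.
rewrite -lee_fin -prbE//.
have := measure_sigma_subadditive (P : {measure set T -> \bar R}) mF mU (@subset_refl _ _).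
move=> /le_trans; apply; apply: le_trans (epsilon_trick0 xpredT a0).
by apply: lee_nneseries => // k _; have := Fa k; rewrite -lee_fin -prbE.
Qed.

Lemma prb0P A : measurable A -> (forall e, 0 < e -> prb A <= e) -> P A = 0%E.
Proof.
move=> mA h; rewrite prbE//; congr EFin; apply/eqP; rewrite eq_le prb_ge0 andbT.
by apply/ler_addgt0Pr => e e0; rewrite add0r; exact: h.
Qed.

Lemma prb_squeeze A B : measurable A -> measurable B -> P (A `+` B) = 0%E ->
  P A = P B.
Proof.
move=> mA mB; have mAB : measurable (A `+` B).
  by apply: measurableU; exact: measurableD.
rewrite prbE// => -[AB]; rewrite !prbE//; congr EFin; apply/eqP.
rewrite eq_le; apply/andP; split.
  rewrite -[leRHS]addr0 -AB; apply: prb_leU => // x Ax.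
  by have [|] := pselect (B x); [left|right; left].
rewrite -[leRHS]addr0 -AB; apply: prb_leU => // x Ax.
by have [|] := pselect (A x); [left|right; right].
Qed.

Lemma prb0_setU A B : measurable A -> measurable B -> P A = 0%E -> P B = 0%E ->
  P (A `|` B) = 0%E.
Proof. by move=> mA mB A0 B0; rewrite null_set_setU. Qed.

Lemma prb0_subset A B : measurable A -> measurable B -> A `<=` B -> P B = 0%E ->
  P A = 0%E.
Proof. by move=> mA mB AB; exact: subset_measure0. Qed.

End real_probability.

Section digit_measurable.
Context d (T : measurableType d).
Implicit Types X Y : T -> nat.

(** Since [nat] is countable, the fibres decide measurability of all preimages; no sigma-algebra on
    [nat] has to be carried along. *)
Definition digit_measurable X := forall i, measurable [set x | X x = i].

Lemma digit_measurable_cst n : digit_measurable (fun=> n).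
Proof.
move=> i; have [->|ni] := eqVneq n i.
  by rewrite [X in measurable X](_ : _ = setT)//; apply/seteqP; split.
rewrite [X in measurable X](_ : _ = set0)//; apply/seteqP.
by split=> // x /= /eqP; rewrite (negbTE ni).
Qed.

Lemma digit_measurable_op (F : nat -> nat -> nat) X Y :
  digit_measurable X -> digit_measurable Y ->
  digit_measurable (fun x => F (X x) (Y x)).
Proof.
move=> mX mY i; rewrite [X in measurable X](_ : _ =
    \bigcup_a \bigcup_(b in [set b | F a b = i])
      ([set x | X x = a] `&` [set x | Y x = b])).
  apply: bigcupT_measurable => a; apply: bigcup_measurable => b _.
  exact: measurableI.
apply/seteqP; split=> x /=.
  by move=> Fi; exists (X x) => //; exists (Y x).
by move=> [a _ [b /= Fab [/= -> ->]]].
Qed.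

Lemma digit_measurable_comp (F : nat -> nat) X :
  digit_measurable X -> digit_measurable (F \o X).
Proof. by move=> mX; exact: (digit_measurable_op (fun a _ => F a) mX mX). Qed.

Lemma digit_measurable_pred X (Q : pred nat) :
  digit_measurable X -> measurable [set x | Q (X x)].
Proof.
move=> mX; rewrite [X in measurable X](_ : _ =
    \bigcup_(i in [set i | Q i]) [set x | X x = i]).
  by apply: bigcup_measurable => i _; exact: mX.
by apply/seteqP; split=> [x Qx|x [i Qi /= ->//]]; exists (X x).
Qed.

End digit_measurable.

Section uniform_digits.
Context d (T : measurableType d) (R : realType) (P : probability T R).

Definition uniform_below N (X : T -> nat) :=
  [/\ forall x, (X x < N)%N,
      digit_measurable X &
      forall i, (i < N)%N -> prb P [set x | X x = i] = N%:R^-1].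

Lemma uniform_prb N X (Q : pred nat) : uniform_below N X ->
  prb P [set x | Q (X x)] = #|[pred e : 'I_N | Q e]|%:R / N%:R.
Proof.
move=> [Xlt mX PX].
have -> : [set x | Q (X x)] = \big[setU/set0]_(e < N | Q e) [set x | X x = e].
  rewrite -bigcup_seq_cond; apply/seteqP; split=> [x Qx|x [e /andP[_ Qe] /= ->//]].
  by exists (Ordinal (Xlt x)) => //=; rewrite mem_index_enum.
apply: EFin_inj; rewrite -prbE; last first.
  by apply: bigsetU_measurable => e _; exact: mX.
rewrite measure_bigsetU_ord//; last first.
  by move=> i j _ _ [x [/= Xi Xj]]; apply: val_inj; rewrite /= -Xi -Xj.
rewrite (eq_bigr (fun=> (N%:R^-1)%:E)); last 
  by move=> e _; exact: etrans (prbE P (mX e)) (congr1 EFin (PX e (ltn_ord e))).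
by rewrite sumEFin sumr_const mulr_natl.
Qed.

Lemma uniform_comp N M X (f : nat -> nat) : uniform_below N X ->
  (forall e, (e < N)%N -> (f e < M)%N) ->
  (forall i, (i < M)%N -> (#|[pred e : 'I_N | f e == i]|%:R / N%:R : R) = M%:R^-1) ->
  uniform_below M (f \o X).
Proof.
move=> uX fM fi; have [Xlt mX PX] := uX; split=> [x||i iM].
- exact: fM.
- exact: digit_measurable_comp.
- have -> : [set x | (f \o X) x = i] = [set x | (fun e => f e == i) (X x)].
    by apply/seteqP; split=> x /= /eqP.
  by rewrite (uniform_prb (fun e => f e == i) uX) fi.
Qed.

End uniform_digits.

(** * Permutations of finite sets of cells *)

Section finite_permutations.
Local Open Scope set_scope.
Local Open Scope nat_scope.

(** Pigeonhole inside a level set of [u]: if [x] is not in [A], the values of [f] in the level set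
    of [x] come from fewer points than the level set contains, so [x] can be sent to a free point
    with the same [u]. *)
Lemma partial_perm_extend (I : finType) (L : eqType) (u : I -> L) (A : {set I})
    (f : I -> I) : {in A &, injective f} -> {in A, forall x, u (f x) = u x} ->
  exists p : {perm I}, {in A, p =1 f} /\ forall x, u (p x) = u x.
Proof.
have [n] := ubnP #|~: A|; elim: n A f => // n IH A f; rewrite ltnS => An injf uf.
have [AT|[x xA]] : A = finset.setT \/ exists x, x \notin A.
  have [A0|/set0Pn[x]] := eqVneq (~: A) finset.set0; last by rewrite inE; right; exists x.
  by left; rewrite -[A]finset.setCK A0 finset.setC0.
  have finj : injective f by move=> a b; apply: injf; rewrite AT inE.
  exists (perm finj); split=> [a _|a]; rewrite permE//.
  by rewrite uf// AT inE.
have [z [zf uz]] : exists z, z \notin f @: A /\ u z = u x.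
  pose U := [set z | u z == u x].
  have : ~~ (U \subset f @: [set a in A | u a == u x]).
    apply/negP => /subset_leq_card; rewrite card_in_imset; last first.
      by move=> a b; rewrite !inE => /andP[aA _] /andP[bA _]; exact: injf.
    rewrite leqNgt => /negP; apply; apply: proper_card; apply/fintype.properP; split.
      by apply/fintype.subsetP=> a; rewrite !inE => /andP[].
    by exists x; rewrite !inE ?eqxx// (negbTE xA).
  case/fintype.subsetPn => z; rewrite inE => /eqP uz zf; exists z; split=> //.
  apply: contra zf => /imsetP[a aA za]; apply/imsetP; exists a => //.
  by rewrite inE aA/= -uz za uf.
pose g a := if a == x then z else f a.
have gA a : a \in A -> g a = f a.
  by move=> aA; rewrite /g; case: eqP => // ax; rewrite -ax aA in xA.
have gx : g x = z by rewrite /g eqxx.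
have [|a b|a|p [pg up]] := IH (x |: A) g.
- apply: leq_trans An; apply: proper_card; apply/fintype.properP; split.
    by apply/fintype.subsetP=> a; rewrite !inE negb_or => /andP[].
  by exists x; rewrite !inE ?eqxx.
- rewrite !inE => /orP[/eqP->|aA] /orP[/eqP->|bA] //; rewrite ?gx ?gA//.
  + by move=> zb; case/negP: zf; rewrite zb imset_f.
  + by move=> za; case/negP: zf; rewrite -za imset_f.
  + exact: injf.
- by rewrite !inE => /orP[/eqP->|aA]; rewrite ?gx ?gA ?uf.
- by exists p; split=> // a aA; rewrite pg ?inE ?aA ?orbT ?gA.
Qed.

Definition perm_below N (s s' : nat -> nat) := forall i, i < N ->
  [/\ s i < N, s' i < N, s' (s i) = i & s (s' i) = i].

Lemma perm_below_sym N s s' : perm_below N s s' -> perm_below N s' s.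
Proof. by move=> h i /h[]. Qed.

Lemma perm_below_of_perm N (p : {perm 'I_N}) :
  exists s s', perm_below N s s' /\ forall i : 'I_N, s i = p i.
Proof.
pose F (q : {perm 'I_N}) i := if insub i is Some j then val (q j) else 0.
have FE q (j : 'I_N) : F q j = q j by rewrite /F valK.
exists (F p), (F p^-1%g); split=> // i iN.
rewrite -[i]/(val (Ordinal iN)) !FE; split; rewrite ?FE ?permK ?permKV //.
Qed.

(** An index below [A * J] encodes the base point [e %/ J] and the fibre point [e %% J]. This is the
    product of [s] with the identity: the same transformation, viewed on cells [J] times finer. *)
Definition fiberwise J (s : nat -> nat) e := s (e %/ J) * J + e %% J.

Lemma fiberwise_perm_below A J s s' : perm_below A s s' ->
  perm_below (A * J) (fiberwise J s) (fiberwise J s').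
Proof.
move=> h e eAJ; have J0 : 0 < J by case: J eAJ => //; rewrite muln0.
have eJ : e %% J < J by rewrite ltn_mod.
have /h[sA s'A ss' s's] : e %/ J < A by rewrite ltn_divLR.
have lt a : a < A -> a * J + e %% J < A * J.
  by move=> aA; apply: leq_trans (_ : a.+1 * J <= _);
    [rewrite mulSn addnC ltn_add2r|rewrite leq_mul2r aA orbT].
have dE a : (a * J + e %% J) %/ J = a by rewrite divnMDl// divn_small// addn0.
have mE a : (a * J + e %% J) %% J = e %% J by rewrite modnMDl modn_mod.
by rewrite /fiberwise !dE !mE ss' s's -divn_eq; split=> //; exact: lt.
Qed.

(* Over each base point the fibre is [0, J); moving along [s] shifts the fibre
   coordinate by [w a - w (s a)], which leaves the fibre only at its two ends. *)
Lemma skew_extension A J s s' (w : nat -> nat) : perm_below A s s' ->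
  (forall a, w a <= 1) ->
  exists S S', [/\ perm_below (A * J) S S',
    forall e, e < A * J -> (S e) %% J + w (S e %/ J) = e %% J + w (e %/ J) &
    #|[pred e : 'I_(A * J) | S e %/ J != s (e %/ J)]| <= A * 2].
Proof.
move=> h w1.
have J0 (e : 'I_(A * J)) : 0 < J by case: J e => [|//] []; rewrite muln0.
have bA (e : 'I_(A * J)) : e %/ J < A by rewrite ltn_divLR// J0.
have bJ (e : 'I_(A * J)) : e %% J < J by rewrite ltn_mod J0.
have enc a j : a < A -> j < J -> a * J + j < A * J.
  move=> aA jJ; apply: leq_trans (_ : a.+1 * J <= _); last by rewrite leq_mul2r aA orbT.
  by rewrite mulSn addnC ltn_add2r.
(* Away from both ends of the fibre: as [w] is 0 or 1, the shift is at most 1 in absolute value and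
   stays in [0, J). *)
pose inner := [set e : 'I_(A * J) | (0 < e %% J) && ((e %% J).+1 < J)].
pose u (e : 'I_(A * J)) := e %% J + w (e %/ J).
pose j' (e : 'I_(A * J)) := e %% J + w (e %/ J) - w (s (e %/ J)).
have j'J (e : 'I_(A * J)) : e \in inner -> j' e < J.
  rewrite inE => /andP[e0 eJ]; rewrite /j'.
  by have := w1 (e %/ J); have := w1 (s (e %/ J)); lia.
pose f (e : 'I_(A * J)) : 'I_(A * J) := insubd e (s (e %/ J) * J + j' e).
have fE (e : 'I_(A * J)) : e \in inner -> val (f e) = s (e %/ J) * J + j' e.
  move=> ei; rewrite /f insubdK// unfold_in /=.
  by apply: enc; [have [] := h _ (bA e)|exact: j'J].
have fdiv (e : 'I_(A * J)) : e \in inner -> f e %/ J = s (e %/ J).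
  by move=> ei; rewrite fE// divnMDl ?(J0 e)// (divn_small (j'J e ei)) addn0.
have fmod (e : 'I_(A * J)) : e \in inner -> f e %% J = j' e.
  by move=> ei; rewrite fE// modnMDl (modn_small (j'J e ei)).
have fu : {in inner, forall e, u (f e) = u e}.
  move=> e ei; rewrite /u fdiv// fmod// /j' subnK//.
  move: ei; rewrite inE => /andP[e0 _].
  by apply: leq_trans (w1 _) _; rewrite (leq_trans e0)// leq_addr.
have finj : {in inner &, injective f}.
  move=> e1 e2 i1 i2 f12; have d12 : e1 %/ J = e2 %/ J.
    have [_ _ <- _] := h _ (bA e1); have [_ _ <- _] := h _ (bA e2).
    by rewrite -!fdiv// f12.
  apply: val_inj; rewrite /= (divn_eq e1 J) (divn_eq e2 J) d12; congr (_ + _).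
  have := fu _ i1; rewrite f12 (fu _ i2) /u d12 => /addIn.
  by [].
(* At the ends of the fibres the permutation is arbitrary except that it still preserves [u]. Thus
   the identity for [w] holds everywhere, and only the agreement with [s] is lost there. *)
have [p [pf up]] := partial_perm_extend finj fu.
have [S [S' [SS' Sp]]] := perm_below_of_perm p.
exists S, S'; split=> //.
  move=> e eAJ; have := up (Ordinal eAJ); rewrite /u -Sp /=; exact.
apply: leq_trans (_ : #|[pred e : 'I_(A * J) | e \notin inner]| <= _).
  apply: subset_leq_card; apply/fintype.subsetP=> e; rewrite !inE.
  by apply: contra => ei; rewrite Sp pf ?inE// fdiv// inE.
(* A point outside [inner] has fibre coordinate 0 or [J - 1], so there are at most two of them over
   each base point. *)
pose g (e : 'I_(A * J)) : 'I_A * bool := (Ordinal (bA e), e %% J == 0).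
have ginj : {in [pred e : 'I_(A * J) | e \notin inner] &, injective g}.
  move=> e1 e2; rewrite !inE => n1 n2 [d12 m12].
  apply: val_inj; rewrite /= (divn_eq e1 J) (divn_eq e2 J) d12; congr (_ + _).
  by have := bJ e1; have := bJ e2; lia.
rewrite -(card_in_image ginj); apply: leq_trans (max_card _) _.
by rewrite card_prod card_ord card_bool.
Qed.

(** The weight [w] of the overview, for the [i]-th cell of level [m], as seen from the finer level
    [N]. *)
Definition cell_weight N m i e : nat := e %/ 2 ^ (N - m) == i.

(** In the finite model the relations between [y] and [w] hold without exception. The bound on [y]
    limits how many thickenings of an error set will be needed. *)
Definition coherent N (s t : nat -> nat) m i (y : nat -> nat) :=
  forall e, e < 2 ^ N -> [/\ y e < 2 ^ N, y (t e) = y e &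
    y (s e) + cell_weight N m i (s e) = y e + cell_weight N m i e].

(** Adding [m] digits makes [w] a function of the base point; [K + 1] further digits form the fibre,
    whose coordinate is [y]. Two bad cells in a fibre of 2^(K+1) give the proportion 2^-K. *)
Lemma refine_pair n s s' t t' m i K :
  perm_below (2 ^ n) s s' -> perm_below (2 ^ n) t t' ->
  exists N S S' Z Z' y,
    [/\ [/\ n < N, m <= N & K < N], perm_below (2 ^ N) S S' /\ perm_below (2 ^ N) Z Z',
        coherent N S Z m i y,
        forall e, e < 2 ^ N -> Z e %/ 2 ^ (N - n) = t (e %/ 2 ^ (N - n)) &
        #|[pred e : 'I_(2 ^ N) | S e %/ 2 ^ (N - n) != s (e %/ 2 ^ (N - n))]|
          * 2 ^ K <= 2 ^ N].
Proof.
move=> hs ht; pose k := K.+1; pose N := n + m + k.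
have NE : 2 ^ N = 2 ^ n * 2 ^ m * 2 ^ k by rewrite -!expnD.
have hs1 := fiberwise_perm_below (J := 2 ^ m) hs.
pose w a : nat := a %/ 2 ^ n == i.
have w1 a : w a <= 1 by exact: leq_b1.
have [S [S' [SS' Su Sbad]]] := skew_extension (2 ^ k) hs1 w1.
have wE e : cell_weight N m i e = w (e %/ 2 ^ k).
  by rewrite /cell_weight /w -divnMA -expnD; congr (_ %/ 2 ^ _ == i); rewrite /N; lia.
have pE e : e %/ 2 ^ (N - n) = e %/ 2 ^ k %/ 2 ^ m.
  by rewrite -divnMA -expnD; congr (_ %/ 2 ^ _); rewrite /N; lia.
have lE J r a : 0 < J -> fiberwise J r a %/ J = r (a %/ J).
  by move=> J0; rewrite /fiberwise divnMDl// (divn_small (ltn_pmod _ J0)) addn0.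
have mE J r a : 0 < J -> fiberwise J r a %% J = a %% J.
  by move=> J0; rewrite /fiberwise modnMDl modn_mod.
have ht2 := fiberwise_perm_below (J := 2 ^ k) (fiberwise_perm_below (J := 2 ^ m) ht).
have p0 r : 0 < 2 ^ r by rewrite expn_gt0.
exists N, S, S', (fiberwise (2 ^ k) (fiberwise (2 ^ m) t)),
  (fiberwise (2 ^ k) (fiberwise (2 ^ m) t')), (fun e => e %% 2 ^ k).
split; rewrite ?NE//.
- by rewrite /N /k; split; lia.
- move=> e eN; split.
  + by apply: leq_trans (_ : 2 ^ k <= _); rewrite ?ltn_mod// NE leq_pmull// muln_gt0 !p0.
  + exact: mE.
  + by rewrite !wE; apply: Su; rewrite -NE.
- by move=> e _; rewrite !pE !lE.
- apply: leq_trans (_ : 2 ^ n * 2 ^ m * 2 * 2 ^ K <= _); last first.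
    by rewrite /k expnS mulnA.
  rewrite leq_mul2r; apply/orP; right; apply: leq_trans Sbad; rewrite -NE.
  apply: subset_leq_card; apply/fintype.subsetP=> e; rewrite !inE.
  by apply: contra => /eqP Se; rewrite !pE Se lE.
Qed.

End finite_permutations.

(** * Dyadic codings *)

Section dyadic_coding.
Context d (T : measurableType d) (R : realType) (P : probability T R).
Implicit Types c : nat -> T -> nat.

Definition dyadic_digits c :=
  (forall n, uniform_below P (2 ^ n)%N (c n)) /\
  (forall n x, c n x = (c n.+1 x)./2).

Lemma dyadic_digits_div c n N x : dyadic_digits c -> (n <= N)%N ->
  c n x = (c N x %/ 2 ^ (N - n))%N.
Proof.
move=> [_ half] /subnKC <-; rewrite addKn; move: (N - n)%N => k.
elim: k => [|k IH]; first by rewrite addn0 divn1.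
by rewrite IH addnS half -divn2 -divnMA -expnS.
Qed.

(* [c n x] is the number formed by the first [n] binary digits of [x]. *)
Record dyadic_coding c : Prop := DyadicCoding {
  coding_digits : dyadic_digits c;
  coding_approx : forall A (e : R), measurable A -> 0 < e ->
    exists n (S : pred nat), prb P (A `+` [set x | S (c n x)]) < e;
  coding_realize : forall c', dyadic_digits c' -> exists f : T -> T,
    [/\ measurable_fun setT f,
        forall A, measurable A -> P (f @^-1` A) = P A &
        \forall x \ae P, forall n, c n (f x) = c' n x];
  coding_separate : exists T1,
    [/\ measurable T1, P (~` T1) = 0%E &
        forall x y, T1 x -> T1 y -> (forall n, c n x = c n y) -> x = y] }.

(** The measure of this set serves as the distance from the map [f] to the finite model [s] of level
    [n]. *)
Definition mismatch c n (s : nat -> nat) (f : T -> T) : set T :=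
  [set x | c n (f x) != s (c n x)].

(* Beats the factor 5 ^ (2 ^ n + 1) lost in thickening an exceptional set as many
   times as a function bounded by 2 ^ n can require. *)
Definition tolerance n : R := (2 ^ n * 5 ^ (2 ^ n).+2)%:R^-1.

Lemma tolerance_gt0 n : 0 < tolerance n.
Proof. by rewrite invr_gt0 ltr0n muln_gt0 !expn_gt0. Qed.

Lemma toleranceS n : tolerance n.+1 <= tolerance n / 2.
Proof.
have pos k : (0 < 2 ^ k * 5 ^ (2 ^ k).+2)%N by rewrite muln_gt0 !expn_gt0.
rewrite /tolerance -invfM -natrM lef_pV2 ?posrE ?ltr0n ?pos//; last by rewrite muln_gt0 pos.
rewrite ler_nat mulnAC -expnSr leq_mul2l; apply/orP; right.
by rewrite leq_exp2l// !ltnS leq_exp2l.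
Qed.

(** The left side equals 2/5 times 2^-n. Its factor 2 stands for the two error sets, of [sigma] and
    of [tau]; the spare factor 5 in [tolerance] brings the product below 2^-(n+1), a summable
    bound. *)
Lemma tolerance_budget n :
  5 ^+ (2 ^ n).+1 * (2 * tolerance n) <= (2 ^ n.+1)%:R^-1.
Proof.
rewrite /tolerance !expnS !natrM exprS [(5 ^ _)%:R]natrX.
suff ineq (a b : R) : 0 < a -> 0 < b ->
    5 * a * (2 * (b * (5 * (5 * a)))^-1) <= (2 * b)^-1.
  by apply: ineq; rewrite ?exprn_gt0// ltr0n expn_gt0.
move=> a0 b0; have -> : 5 * a * (2 * (b * (5 * (5 * a)))^-1) = (2 / 5) * b^-1.
  by field; rewrite !gt_eqF.
by rewrite invfM ler_pM2r ?invr_gt0//; lra.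
Qed.

End dyadic_coding.

Section invertible_maps.
Context d (T : measurableType d) (R : realType) (P : probability T R).
Implicit Types f : imp_map P.

Lemma imp_inverse f : exists g, [/\ cancel f g, cancel g f & measurable_fun setT g].
Proof. by have [_ _] := imp_funP f. Qed.

Lemma imp_measurable_fun f : measurable_fun setT f.
Proof. by have [] := imp_funP f. Qed.

Lemma imp_preimage_measurable f A : measurable A -> measurable (f @^-1` A).
Proof. by move=> mA; rewrite -[_ @^-1` _]setTI; exact: (imp_measurable_fun f measurableT mA). Qed.

Lemma imp_preimage_prb f A : measurable A -> prb P (f @^-1` A) = prb P A.
Proof. by move=> mA; rewrite /prb; have [_ h _] := imp_funP f; rewrite h. Qed.

Lemma imp_image_measurable f A : measurable A -> measurable (f @` A).
Proof.
have [g [fg gf mg]] := imp_inverse f.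
have -> : f @` A = g @^-1` A.
  by apply/seteqP; split=> [_ [x Ax <-]|y Ay] /=; [rewrite fg|exists (g y)].
by move=> mA; rewrite -[_ @^-1` _]setTI; exact: mg.
Qed.

Lemma imp_image_prb f A : measurable A -> prb P (f @` A) = prb P A.
Proof.
move=> mA; rewrite -(imp_preimage_prb f (imp_image_measurable f mA)).
congr (prb P _); apply/seteqP; split=> x /=; last by exists x.
by have [g [fg _ _]] := imp_inverse f; move=> [y Ay /(can_inj fg) <-].
Qed.

(** * Capping by the distance to an exceptional set *)

Section cap.
Context (sigma tau : imp_map P).

(** One step in the graph that joins [x] to [sigma x] and to [tau x]. Both directions are needed for
    a symmetric distance, whence five sets of the measure of [Z]. *)
Definition thicken (Z : set T) : set T :=
  Z `|` (sigma @^-1` Z `|` (tau @^-1` Z `|` (sigma @` Z `|` tau @` Z))).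

Lemma thicken_measurable Z : measurable Z -> measurable (thicken Z).
Proof.
move=> mZ; have mp f := imp_preimage_measurable f mZ.
have mi f := imp_image_measurable f mZ.
by do 4 (apply: measurableU => //).
Qed.

Lemma thicken_prb Z : measurable Z -> prb P (thicken Z) <= 5 * prb P Z.
Proof.
move=> mZ; have mp f := imp_preimage_measurable f mZ.
have mi f := imp_image_measurable f mZ.
have h1 := prbU P (mi sigma) (mi tau).
have m1 := measurableU _ _ (mi sigma) (mi tau).
have h2 := prbU P (mp tau) m1; have m2 := measurableU _ _ (mp tau) m1.
have h3 := prbU P (mp sigma) m2; have m3 := measurableU _ _ (mp sigma) m2.
have h4 := prbU P mZ m3.
move: h1 h2 h3 h4; rewrite !imp_preimage_prb// !imp_image_prb// /thicken; lra.
Qed.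

Definition thickened Z k := iter k thicken Z.

Lemma thickened_measurable Z k : measurable Z -> measurable (thickened Z k).
Proof. by move=> mZ; elim: k => //= k; exact: thicken_measurable. Qed.

Lemma thickened_prb Z k : measurable Z -> prb P (thickened Z k) <= 5 ^+ k * prb P Z.
Proof.
move=> mZ; elim: k => [|k IH]; first by rewrite mul1r.
apply: le_trans (thicken_prb (thickened_measurable k mZ)) _.
by rewrite exprS -mulrA ler_pM2l.
Qed.

Lemma thickened_le Z k l : (k <= l)%N -> thickened Z k `<=` thickened Z l.
Proof.
elim: l => [|l IH]; first by rewrite leqn0 => /eqP ->.
by rewrite leq_eqVlt => /predU1P[->//|/IH kl] x /kl Zx; left.
Qed.

(** The graph distance to [Z], truncated at [L]: the thickenings increase, so the number of those
    missing [x] is the index of the first one that contains it. *)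
Definition depth Z L x : nat := (\sum_(k < L) ~~ `[< thickened Z k x >])%N.

(** Splitting off the first term for [y], which is at most 1, and the last term for [x] leaves sums
    that compare term by term. *)
Lemma depth_lip Z L x y :
  (forall k, thickened Z k x -> thickened Z k.+1 y) ->
  (depth Z L y <= (depth Z L x).+1)%N.
Proof.
move=> xy; case: L => [|L]; first by rewrite /depth !big_ord0.
rewrite /depth big_ord_recl [X in (_ <= X.+1)%N]big_ord_recr /= -add1n leq_add ?leq_b1//.
apply: leq_trans (leq_addr _ _); apply: leq_sum => k _ /=.
by case: asboolP => //= nk; case: asboolP => // /xy.
Qed.

Lemma depth_max Z L x : ~ thickened Z L x -> depth Z L x = L.
Proof.
move=> nx; rewrite /depth (eq_bigr (fun=> 1%N)) ?sum1_card ?card_ord// => k _.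
by case: asboolP => // /(thickened_le (ltnW (ltn_ord k))).
Qed.

Lemma depth0 Z L x : Z x -> depth Z L x = 0%N.
Proof.
move=> Zx; rewrite /depth big1// => k _.
by case: asboolP => // -[]; exact: (thickened_le (leq0n k)).
Qed.

Lemma depth_measurable Z L : measurable Z -> digit_measurable (depth Z L).
Proof.
move=> mZ; elim: L => [|L IH].
  rewrite [depth Z 0](_ : _ = fun=> 0%N); last by apply/funext => x; rewrite /depth big_ord0.
  exact: digit_measurable_cst.
rewrite [depth Z L.+1](_ : _ =
  fun x => (depth Z L x + ~~ `[< thickened Z L x >])%N); last first.
  by apply/funext => x; rewrite /depth big_ord_recr.
apply: (digit_measurable_op addn) IH _ => i.
have mZL := thickened_measurable L mZ.
case: i => [|[|i]].
- rewrite [X in measurable X](_ : _ = thickened Z L)//.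
  by apply/seteqP; split=> x /=; case: asboolP.
- rewrite [X in measurable X](_ : _ = ~` thickened Z L); last first.
    by apply/seteqP; split=> x /=; case: asboolP.
  exact: measurableC.
- rewrite [X in measurable X](_ : _ = set0)//.
  by apply/seteqP; split=> x //=; case: asboolP.
Qed.

(* The function [y] becomes slowly varying along all orbits once it is capped by
   the number of steps needed to reach the exceptional set [Z0]. *)
Lemma lipschitz_cap (y w : T -> nat) L Z0 : measurable Z0 ->
  digit_measurable y -> (forall x, y x <= L)%N -> (forall x, w x <= 1)%N ->
  (forall x, ~ Z0 x -> y (tau x) = y x /\ y (sigma x) + w (sigma x) = y x + w x)%N ->
  exists (y' : T -> nat) (Z : set T),
    [/\ measurable Z /\ prb P Z <= 5 ^+ L.+1 * prb P Z0,
        digit_measurable y', forall x, (y' x <= L)%N,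
        forall x, (y' (tau x) <= (y' x).+1)%N /\ (y' x <= (y' (tau x)).+1)%N /\
                  (y' (sigma x) <= (y' x).+1)%N /\ (y' x <= (y' (sigma x)).+1)%N &
        forall x, ~ Z x -> y' (tau x) = y' x /\
          (y' (sigma x) + w (sigma x) = y' x + w x)%N].
Proof.
move=> mZ0 my yL w1 hy.
have adj f : (f = sigma \/ f = tau) -> forall Z x,
    (Z x -> thicken Z (f x)) /\ (Z (f x) -> thicken Z x).
  move=> [->|->] Z x; split=> Zx.
  - by right; right; right; left; exists x.
  - by right; left.
  - by right; right; right; right; exists x.
  - by right; right; left.
have lip f x : f = sigma \/ f = tau ->
    (depth Z0 L (f x) <= (depth Z0 L x).+1)%N /\
    (depth Z0 L x <= (depth Z0 L (f x)).+1)%N.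
  by move=> /adj fa; split; apply: depth_lip => k; have [] := fa (thickened Z0 k) x.
(* With [L + 1] thickenings instead of [L], a point outside has depth [L] together with its images
   under [sigma] and [tau]; as [y] is at most [L], the cap is inactive at all three. *)
exists (fun x => minn (y x) (depth Z0 L x)), (thickened Z0 L.+1); split.
- by split; [exact: thickened_measurable|exact: thickened_prb].
- exact: (digit_measurable_op minn) my (depth_measurable L mZ0).
- by move=> x; rewrite geq_min yL.
- move=> x; have [s1 s2] := lip sigma x (or_introl erefl).
  have [t1 t2] := lip tau x (or_intror erefl).
  have [Zx|/hy[yt ys]] := pselect (Z0 x).
    (* On [Z0] nothing is known about [y], but the depth is 0 there and at most 1 at the images, so
       the minimum still moves by at most 1. *)
    by rewrite (depth0 L Zx) in s1 t1 *; lia.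
  by have := w1 x; have := w1 (sigma x); lia.
- move=> x nZ; have nZx : ~ thickened Z0 L x by move=> Zx; apply: nZ; left.
  have dx := depth_max nZx.
  have dt : depth Z0 L (tau x) = L.
    by apply: depth_max => /(adj tau (or_intror erefl) _ _).2.
  have ds : depth Z0 L (sigma x) = L.
    by apply: depth_max => /(adj sigma (or_introl erefl) _ _).2.
  rewrite dx dt ds !(minn_idPl _)//; apply: hy => Zx; apply: nZx.
  exact: (thickened_le (leq0n L)).
Qed.

End cap.
End invertible_maps.

(** * Integrals along measure-preserving maps *)

Section real_integrals.
Context d (T : measurableType d) (R : realType) (P : probability T R).
Implicit Types F G Y : T -> R.

Local Notation L1 F := (P.-integrable setT (EFin \o F)).

Lemma digit_measurable_natr (y : T -> nat) : digit_measurable y ->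
  measurable_fun setT (fun x => (y x)%:R : R).
Proof.
move=> my _ B mB; rewrite setTI.
rewrite [X in measurable X](_ : _ = \bigcup_(i in [set i : nat | B i%:R]) [set x | y x = i]).
  by apply: bigcup_measurable => i _; exact: my.
by apply/seteqP; split=> [x By|x [i Bi /= yi]]; [exists (y x)|rewrite /= yi].
Qed.

Lemma integrable_mul_bounded F Y (M : R) : L1 F -> measurable_fun setT Y ->
  (forall x, `|Y x| <= M) -> L1 (fun x => F x * Y x).
Proof.
move=> iF mY YM; have := integrableMl measurableT iF mY; apply.
exists M; split; first exact: num_real.
by move=> N MN x _; apply: le_trans (YM x) (ltW MN).
Qed.

Lemma integrable_subr F G : L1 F -> L1 G -> L1 (fun x => F x - G x).
Proof. by move=> iF iG; exact: (integrableB measurableT iF iG). Qed.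

Lemma integrable_addr F G : L1 F -> L1 G -> L1 (fun x => F x + G x).
Proof. by move=> iF iG; exact: (integrableD measurableT iF iG). Qed.

Lemma imp_integral (f : imp_map P) F : L1 F ->
  L1 (F \o f) /\ (\int[P]_x F (f x) = \int[P]_x F x)%R.
Proof.
move=> iF; have [mf fP _] := imp_funP f.
have mF := measurable_int _ iF.
have E (G : T -> \bar R) : (\int[P]_x G x = \int[pushforward P f]_x G x)%E.
  by apply: eq_measure_integral => A mA _; exact: (esym (fP A mA)).
have iFf : L1 (F \o f).
  apply/integrableP; split.
    by apply/measurable_EFinP; apply: measurableT_comp => //; exact/measurable_EFinP.
  have /integrableP[_] := iF; rewrite E ge0_integral_pushforward//.
  exact: measurableT_comp.
split=> //; rewrite /Rintegral [in RHS]E.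
by rewrite (integral_pushforward mf mF)// preimage_setT.
Qed.

Lemma ae_eq_Rintegral F G : L1 F -> L1 G ->
  (\forall x \ae P, F x = G x) -> \int[P]_x F x = \int[P]_x G x.
Proof.
move=> iF iG FG; rewrite /Rintegral; congr fine; apply: ae_eq_integral => //.
- exact: measurable_int iF.
- exact: measurable_int iG.
- by apply: filterS FG => x /= -> _.
Qed.

Lemma integrable_indic_mul F A : L1 F -> measurable A ->
  L1 (fun x => F x * \1_A x).
Proof.
move=> iF mA; apply: (integrable_mul_bounded (M := 1) iF).
  exact: measurable_indic.
by move=> x; rewrite indicE; case: (x \in A); rewrite ?normr1 ?normr0.
Qed.

(** Borel-Cantelli: almost every point lies in only finitely many [Z l], so the integrands tend to 0
    almost everywhere, dominated by [|F|]. Nothing beyond integrability of [F] is involved. *)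
Lemma integral_shrinking F (Z : (set T)^nat) : L1 F ->
  (forall l, measurable (Z l)) -> (forall l, prb P (Z l) <= (2 ^ l.+1)%:R^-1) ->
  forall e : R, 0 < e -> exists l, \int[P]_x (`|F x| * \1_(Z l) x) <= e.
Proof.
move=> iF mZ PZ e e0.
have iN : L1 (fun x => `|F x|) by exact: (integrable_norm iF).
have i_ l := integrable_indic_mul iN (mZ l).
have Z0 : P (lim_sup_set Z) = 0%E.
  apply: lim_sup_set_cvg0 => //.
  apply: (@le_lt_trans _ _ (\sum_(n <oo) (1 / (2 ^ n.+1)%:R)%:E)%E).
    apply: lee_nneseries => // l _; have := PZ l.
    by rewrite -lee_fin -prbE// div1r.
  exact: le_lt_trans (epsilon_trick0 xpredT ler01) (ltry _).
have [] := @dominated_convergence _ _ _ P setT measurableT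
    (fun l x => (`|F x| * \1_(Z l) x)%:E) (cst 0%E) (fun x => (`|F x|)%:E) _ _ _ iN.
- by move=> l; exact: measurable_int (i_ l).
- exact: measurable_cst.
- exists (lim_sup_set Z); split=> //.
    apply: bigcap_measurable => // k _; apply: bigcup_measurable => j _; exact: mZ.
  move=> x /= nx n _; apply: contrapT => nZ; apply: nx => _.
  apply: cvg_near_cst; exists n => // j /= nj.
  rewrite indicE memNset ?mulr0// => Zj; apply: nZ; exists j => //.
- apply: aeW => x l _; rewrite gee0_abs ?lee_fin.
    by rewrite ler_piMr// indicE; case: (_ \in _).
  by rewrite mulr_ge0// indicE; case: (_ \in _).
move=> _ _; rewrite integral_cst// mul0e => cv.
have := cv _ (@nbhs_open_ereal_lt R 0 (fun=> e) e0) => -[l _ /(_ l (leqnn _))] /= le.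
exists l; rewrite /Rintegral -lee_fin fineK ?ltW//.
exact: integrable_fin_num (i_ l).
Qed.

End real_integrals.

(** * Pairing a coboundary with a slowly varying function *)

Section coboundary_pairing.
Context d (T : measurableType d) (R : realType) (P : probability T R).

Local Notation L1 F := (P.-integrable setT (EFin \o F)).

(** Summation by parts: invariance of [P] replaces the integral of [h Y] by that of its composition
    with [f], so the transfer function only meets the increment of [Y]. *)
Lemma coboundary_pairing (f : imp_map P) (h Y : T -> R) M : L1 h ->
  measurable_fun setT Y -> (forall x, `|Y x| <= M) ->
  \int[P]_x ((h x - h (f x)) * Y x) = \int[P]_x (h (f x) * (Y (f x) - Y x)).
Proof.
move=> ih mY YM; have [ihf _] := imp_integral f ih.
have mYf : measurable_fun setT (Y \o f).
  exact: measurableT_comp mY (imp_measurable_fun f).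
have i1 := integrable_mul_bounded ih mY YM.
have i2 := integrable_mul_bounded ihf mY YM.
have i3 := integrable_mul_bounded ihf mYf (fun x => YM (f x)).
have [_ E] := imp_integral f i1.
transitivity (\int[P]_x (h x * Y x) - \int[P]_x (h (f x) * Y x)).
  by rewrite -RintegralB//; apply: eq_Rintegral => x _; rewrite mulrBl.
by rewrite -E -RintegralB//; apply: eq_Rintegral => x _; rewrite mulrBr.
Qed.

Lemma Rintegral_small_support (F G : T -> R) Z C : 0 <= C -> L1 F ->
  measurable_fun setT G -> measurable Z -> (forall x, `|G x| <= C * \1_Z x) ->
  `|\int[P]_x (F x * G x)| <= C * \int[P]_x (`|F x| * \1_Z x).
Proof.
move=> C0 iF mG mZ GZ.
have GC x : `|G x| <= C.
  apply: le_trans (GZ x) _; rewrite indicE; case: (_ \in _); rewrite ?mulr1 ?mulr0//.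
have iFG := integrable_mul_bounded iF mG GC.
have iN := integrable_indic_mul (integrable_norm iF) mZ.
apply: le_trans (le_normr_Rintegral measurableT iFG) _.
rewrite -RintegralZl//; apply: le_Rintegral => //.
- exact: integrable_norm.
- exact: (integrableZl measurableT C iN).
- by move=> x _; rewrite normrM mulrCA ler_wpM2l.
Qed.

(** With [U = Y + W], the integral against [W] is the one against [U], computed with [g] along
    [sigma], minus the one against [Y], computed with [h] along [tau]. The increments vanish off [Z]
    and are at most 2 and 1 on it. The size [L] of [y] enters only through the measure of [Z]. *)
Lemma common_coboundary_bound (sigma tau : imp_map P) (h g : T -> R)
    (y w : T -> nat) L Z0 :
  L1 h -> L1 g ->
  (\forall x \ae P, h x - h (tau x) = g x - g (sigma x)) ->
  measurable Z0 -> digit_measurable y -> digit_measurable w ->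
  (forall x, y x <= L)%N -> (forall x, w x <= 1)%N ->
  (forall x, ~ Z0 x -> y (tau x) = y x /\ y (sigma x) + w (sigma x) = y x + w x)%N ->
  exists Z, [/\ measurable Z, prb P Z <= 5 ^+ L.+1 * prb P Z0 &
    `|\int[P]_x ((h x - h (tau x)) * (w x)%:R)| <=
    \int[P]_x (`|(`|h (tau x)| + 2 * `|g (sigma x)|)| * \1_Z x)].
Proof.
move=> ih ig hg mZ0 my mw yL w1 hy.
have [y' [Z [[mZ PZ] my' y'L lip yZ]]] := lipschitz_cap mZ0 my yL w1 hy.
exists Z; split=> //.
pose Y x : R := (y' x)%:R; pose W x : R := (w x)%:R.
have mY : measurable_fun setT Y := digit_measurable_natr my'.
have mW : measurable_fun setT W := digit_measurable_natr mw.
have YM x : `|Y x| <= L%:R by rewrite normr_nat ler_nat.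
have WM x : `|W x| <= 1 by rewrite normr_nat (ler_nat _ _ 1%N).
pose U x := Y x + W x.
have mU : measurable_fun setT U by exact: measurable_funD.
have UM x : `|U x| <= L%:R + 1.
  by apply: le_trans (ler_normD _ _) _; rewrite lerD.
have [iht _] := imp_integral tau ih; have [igs _] := imp_integral sigma ig.
have if_ := integrable_subr ih iht; have ik := integrable_subr ig igs.
have mc (f : imp_map P) (V : T -> R) :
    measurable_fun setT V -> measurable_fun setT (fun x => V (f x) - V x).
  move=> mV; apply: measurable_funB => //.
  exact: measurableT_comp mV (imp_measurable_fun f).
have E1 : \int[P]_x ((h x - h (tau x)) * W x) =
    \int[P]_x (g (sigma x) * (U (sigma x) - U x)) -
    \int[P]_x (h (tau x) * (Y (tau x) - Y x)).
  rewrite -(coboundary_pairing sigma ig mU UM) -(coboundary_pairing tau ih mY YM).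
  have -> : \int[P]_x ((g x - g (sigma x)) * U x) =
      \int[P]_x ((h x - h (tau x)) * U x).
    apply: ae_eq_Rintegral.
    - exact: integrable_mul_bounded ik mU UM.
    - exact: integrable_mul_bounded if_ mU UM.
    - by apply: filterS hg => x ->.
  rewrite -RintegralB//.
  - by apply: eq_Rintegral => x _; rewrite /U; ring.
  - exact: integrable_mul_bounded if_ mU UM.
  - exact: integrable_mul_bounded if_ mY YM.
rewrite E1; apply: le_trans (ler_normB _ _) _.
have B1 : `|\int[P]_x (h (tau x) * (Y (tau x) - Y x))| <=
    1 * \int[P]_x (`|h (tau x)| * \1_Z x).
  apply: Rintegral_small_support => //; first exact: mc.
  move=> x; have [t1 [t2 _]] := lip x; rewrite indicE mul1r.
  have [Zx|nZ] := pselect (Z x); last first.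
    by rewrite memNset// /Y (yZ x nZ).1 subrr normr0.
  rewrite mem_set// /Y; move: t1 t2; rewrite -!(ler_nat R) -!natr1 ler_norml => *.
  by apply/andP; split; lra.
have B2 : `|\int[P]_x (g (sigma x) * (U (sigma x) - U x))| <=
    2 * \int[P]_x (`|g (sigma x)| * \1_Z x).
  apply: Rintegral_small_support => //; first exact: mc.
  move=> x; have [_ [_ [s1 s2]]] := lip x; rewrite indicE.
  have [Zx|nZ] := pselect (Z x); last first.
    by rewrite memNset// /U /Y /W -!natrD (yZ x nZ).2 subrr normr0 mulr0.
  rewrite mem_set// mulr1 /U /Y /W.
  have := w1 x; have := w1 (sigma x).
  move: s1 s2; rewrite -!(ler_nat R) -!natr1 ler_norml => *.
  have := ler0n R (w x); have := ler0n R (w (sigma x)) => *.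
  by apply/andP; split; lra.
apply: le_trans (lerD B2 B1) _.
have iN := integrable_indic_mul (integrable_norm iht) mZ.
have iG := integrable_indic_mul (integrable_norm igs) mZ.
rewrite mul1r -RintegralZl// -RintegralD//; last exact: (integrableZl measurableT 2 iG).
rewrite le_eqVlt; apply/orP; left; apply/eqP; apply: eq_Rintegral => x _.
by rewrite [X in _ = X * _]ger0_norm ?addr_ge0 ?mulr_ge0//=; ring.
Qed.

End coboundary_pairing.

(** * Pairs close to coherent finite models *)

Section model_pairs.
Context d (T : measurableType d) (R : realType) (P : probability T R).
Variables (c : nat -> T -> nat) (cod : dyadic_coding P c).

Local Notation L1 F := (P.-integrable setT (EFin \o F)).

(** The level [N] is free and the error is measured against it, because [y] can reach 2^N. The
    strict inequalities make the set open. Requiring all [l] yields models of arbitrarily high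
    level, hence error sets of summable measure. *)
Definition model_pairs m i l : set (maps P * maps P) :=
  [set st : maps P * maps P | exists N s t y, [/\ (l <= N)%N, (m <= N)%N, coherent N s t m i y,
    prb P (mismatch c N s st.1) < tolerance R N &
    prb P (mismatch c N t st.2) < tolerance R N]].

Lemma code_lt n x : (c n x < 2 ^ n)%N.
Proof. by have [u _] := coding_digits cod; have [lt _ _] := u n. Qed.

Lemma code_measurable n : digit_measurable (c n).
Proof. by have [u _] := coding_digits cod; have [_ mc _] := u n. Qed.

Lemma code_div n N x : (n <= N)%N -> c n x = (c N x %/ 2 ^ (N - n))%N.
Proof. exact: dyadic_digits_div (coding_digits cod). Qed.

Lemma mismatch_measurable n s (f : T -> T) : measurable_fun setT f ->
  measurable (mismatch c n s f).
Proof.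
move=> mf; have mcf : digit_measurable (c n \o f).
  move=> i; have := mf measurableT _ (code_measurable n i).
  by rewrite setTI.
have := digit_measurable_op (fun a b => nat_of_bool (a != s b)) mcf (code_measurable n).
move=> /(digit_measurable_pred (fun k => k == 1%N)); congr measurable.
by apply/seteqP; split=> x /=; rewrite /mismatch /=; case: (_ != _).
Qed.

Lemma cell_weightE N m i x : (m <= N)%N ->
  cell_weight N m i (c N x) = (c m x == i).
Proof. by move=> mN; rewrite /cell_weight -code_div. Qed.

Lemma model_pairs_orthogonal (sigma tau : maps P) (h g : T -> R) m i :
  (forall l, model_pairs m i l (sigma, tau)) -> L1 h -> L1 g ->
  (\forall x \ae P, h x - h (tau x) = g x - g (sigma x)) ->
  \int[P]_x ((h x - h (tau x)) * (nat_of_bool (c m x == i))%:R) = 0.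
Proof.
move=> mp ih ig hg.
set I := \int[P]_x _; pose k x : R := `|h (tau x)| + 2 * `|g (sigma x)|.
have [iht _] := imp_integral (repr tau) ih.
have [igs _] := imp_integral (repr sigma) ig.
have ik : L1 k.
  apply: (integrable_addr (integrable_norm iht)).
  exact: (integrableZl measurableT 2 (integrable_norm igs)).
have /choice[Z hZ] : forall l, exists Z, [/\ measurable Z,
    prb P Z <= (2 ^ l.+1)%:R^-1 & `|I| <= \int[P]_x (`|k x| * \1_Z x)].
  move=> l; have [N [s [t [y [lN mN coh ms mt]]]]] := mp l.
  have m1 := mismatch_measurable N s (imp_measurable_fun (repr sigma)).
  have m2 := mismatch_measurable N t (imp_measurable_fun (repr tau)).
  have [|x|x|x nZ|Z [mZ PZ IZ]] := @common_coboundary_bound _ _ _ P (repr sigma) (repr tau)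
    h g (y \o c N) (fun x => nat_of_bool (c m x == i)) (2 ^ N)%N
    (mismatch c N s sigma `|` mismatch c N t tau) ih ig hg (measurableU _ _ m1 m2)
    (digit_measurable_comp y (code_measurable N)).
  - exact: (digit_measurable_comp (fun a => nat_of_bool (a == i)) (code_measurable m)).
  - by have [/ltnW] := coh _ (code_lt N x).
  - exact: leq_b1.
  - have [yN yt ys] := coh _ (code_lt N x).
    have sx : c N (sigma x) = s (c N x).
      by apply: contrapT => /eqP ne; apply: nZ; left.
    have tx : c N (tau x) = t (c N x).
      by apply: contrapT => /eqP ne; apply: nZ; right.
    rewrite -!(cell_weightE i _ mN) /=; change (repr tau x) with (tau x).
    by change (repr sigma x) with (sigma x); rewrite sx tx yt ys.
  exists Z; split=> //; apply: le_trans PZ _.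
  apply: (@le_trans _ _ (5 ^+ (2 ^ N).+1 * (2 * tolerance R N))).
    rewrite ler_pM2l ?exprn_gt0//; apply: le_trans (prbU P m1 m2) _.
    by rewrite mulrDl mul1r lerD// ltW.
  apply: le_trans (tolerance_budget R N) _.
  by rewrite lef_pV2 ?posrE ?ltr0n ?expn_gt0// ler_nat leq_exp2l.
have I0 e : 0 < e -> `|I| <= e.
  move=> e0; have [l le] := integral_shrinking ik (fun l => let: And3 a _ _ := hZ l in a)
    (fun l => let: And3 _ b _ := hZ l in b) e0.
  by have [_ _ Il] := hZ l; exact: le_trans Il le.
apply/normr0_eq0/eqP; rewrite eq_le normr_ge0 andbT.
by apply/ler_addgt0Pr => e e0; rewrite add0r; exact: I0.
Qed.

Lemma orthogonal_digits_pred (f : T -> R) n (S : pred nat) : L1 f ->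
  (forall i, \int[P]_x (f x * (nat_of_bool (c n x == i))%:R) = 0) ->
  \int[P]_x (f x * \1_[set x | S (c n x)] x) = 0.
Proof.
(* Only the cells of index below [k] are counted, for an induction on [k]; codes are below 2^n, so
   [k = 2 ^ n] gives the whole set. *)
move=> iF f0; pose W k x : R := (nat_of_bool (S (c n x) && (c n x < k)%N))%:R.
have mi (Q : nat -> bool) : measurable_fun setT (fun x => (nat_of_bool (Q (c n x)))%:R : R).
  apply: digit_measurable_natr.
  exact: (digit_measurable_comp (fun a => nat_of_bool (Q a)) (code_measurable n)).
have bd (b : bool) : `|(nat_of_bool b)%:R : R| <= 1.
  by case: b; rewrite ?normr1 ?normr0.
have iW (Q : nat -> bool) : L1 (fun x => f x * (nat_of_bool (Q (c n x)))%:R).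
  by apply: (integrable_mul_bounded (M := 1) iF) => //; exact: mi.
have W0 k : \int[P]_x (f x * W k x) = 0.
  elim: k => [|k IH].
    transitivity (\int[P]_(x in setT) (0 : R)); last by rewrite Rintegral_cst// mul0r.
    by apply: eq_Rintegral => x _; rewrite /W ltn0 andbF mulr0.
  have [Sk|Sk] := boolP (S k).
    have E x : f x * W k.+1 x = f x * W k x + f x * (nat_of_bool (c n x == k))%:R.
      rewrite -mulrDr -natrD; congr (_ * _%:R); rewrite ltnS leq_eqVlt.
      by have [->|ne] := eqVneq (c n x) k; rewrite ?Sk ?ltnn ?andbF ?orTb ?addn0 ?andbT.
    transitivity (\int[P]_x (f x * W k x + f x * (nat_of_bool (c n x == k))%:R)).
      by apply: eq_Rintegral => x _; exact: E.
    rewrite RintegralD// ?IH ?f0 ?addr0//.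
      exact: (iW (fun a => S a && (a < k)%N)).
    exact: (iW (fun a => a == k)).
  rewrite -[RHS]IH; apply: eq_Rintegral => x _; congr (_ * _%:R).
  rewrite ltnS leq_eqVlt.
  by have [->|ne] := eqVneq (c n x) k; rewrite ?(negbTE Sk).
rewrite -[RHS](W0 (2 ^ n)%N); apply: eq_Rintegral => x _; congr (_ * _).
rewrite indicE /W code_lt andbT; congr (nat_of_bool _)%:R.
by apply/idP/idP => [/set_mem|Sx]; last exact: mem_set.
Qed.

Lemma orthogonal_digits_ae0 (f : T -> R) : L1 f ->
  (forall n i, \int[P]_x (f x * (nat_of_bool (c n x == i))%:R) = 0) ->
  \forall x \ae P, f x = 0.
Proof.
move=> iF f0.
have ind0 A : measurable A -> \int[P]_x (f x * \1_A x) = 0.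
  (* The approximants get summable errors, so that [integral_shrinking] applies to the symmetric
     differences: one small error would not control the integral of a merely integrable [f]
     uniformly. *)
  move=> mA; have /choice[B hB] : forall l, exists B, [/\ measurable B,
      prb P (A `+` B) <= (2 ^ l.+1)%:R^-1 & \int[P]_x (f x * \1_B x) = 0].
    move=> l; have e0 : (0 : R) < (2 ^ l.+1)%:R^-1 by rewrite invr_gt0 ltr0n expn_gt0.
    have [n [S AS]] := coding_approx cod mA e0.
    exists [set x | S (c n x)]; split; last exact: orthogonal_digits_pred.
      exact: digit_measurable_pred (code_measurable n).
    exact: ltW.
  have mAB l : measurable (A `+` B l).
    by have [mB _ _] := hB l; apply: measurableU; exact: measurableD.
  apply/normr0_eq0/eqP; rewrite eq_le normr_ge0 andbT.
  apply/ler_addgt0Pr => e e0; rewrite add0r.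
  have [l] := integral_shrinking iF mAB (fun l => let: And3 _ b _ := hB l in b) e0.
  apply: le_trans; have [mB _ B0] := hB l.
  have -> : \int[P]_x (f x * \1_A x) = \int[P]_x (f x * (\1_A x - \1_(B l) x)).
    rewrite -[LHS]subr0 -B0 -RintegralB//; try exact: integrable_indic_mul.
    by apply: eq_Rintegral => x _; rewrite mulrBr.
  rewrite -[leRHS]mul1r; apply: Rintegral_small_support => //.
    by apply: measurable_funB; exact: measurable_indic.
  move=> x; rewrite mul1r !indicE.
  have [Ax|nA] := pselect (A x); have [Bx|nB] := pselect (B l x).
  - by rewrite (mem_set Ax) (mem_set Bx) subrr normr0.
  - by rewrite (mem_set Ax) (memNset nB) subr0 normr1 mem_set//; left.
  - by rewrite (memNset nA) (mem_set Bx) sub0r normrN normr1 mem_set//; right.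
  - by rewrite (memNset nA) (memNset nB) subrr normr0.
have /= := @integral_ae_eq _ _ _ P setT measurableT (cst 0%E) (EFin \o f) iF
  (measurable_cst _).
move=> h; have : ae_eq P setT (EFin \o f) (cst 0%E).
  apply: h => A _ mA; rewrite integral_cst// mul0e.
  have := ind0 A mA; rewrite /Rintegral => I0.
  have iA := integrable_indic_mul iF mA.
  transitivity (\int[P]_x (f x * \1_A x)%:E)%E.
    rewrite integral_mkcond; apply: eq_integral => x _.
    by rewrite epatch_indic /= EFinM.
  by rewrite -(fineK (integrable_fin_num measurableT iA)) I0.
by apply: filterS => x /(_ Logic.I) [].
Qed.

Lemma model_pairs_trivial (sigma tau : maps P) (h g : T -> R) :
  (forall m i l, model_pairs m i l (sigma, tau)) -> L1 h -> L1 g ->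
  (\forall x \ae P, h x - h (tau x) = g x - g (sigma x)) ->
  \forall x \ae P, h x - h (tau x) = 0.
Proof.
move=> mp ih ig hg; apply: orthogonal_digits_ae0.
  by have [iht _] := imp_integral (repr tau) ih; exact: integrable_subr.
by move=> n i; exact: model_pairs_orthogonal (mp n i) ih ig hg.
Qed.

End model_pairs.

(** * Limits of finite models *)

Lemma card_div_fiber A J i : (i < A)%N ->
  #|[pred e : 'I_(A * J) | (e %/ J)%N == i]| = J.
Proof.
move=> iA; have lt (j : 'I_J) : (i * J + j < A * J)%N.
  apply: leq_trans (_ : i.+1 * J <= _)%N; last by rewrite leq_mul2r iA orbT.
  by rewrite mulSn addnC ltn_add2r.
pose f (j : 'I_J) := Ordinal (lt j).
have finj : injective f by move=> j k [/addnI /val_inj].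
rewrite -[RHS]card_ord -(card_codom finj); apply: eq_card => e; rewrite inE.
apply/eqP/codomP => [ei|[j ->] /=]; last first.
  have jJ := ltn_ord j; rewrite divnMDl ?(leq_trans _ jJ)//.
  by rewrite (divn_small jJ) addn0.
have J0 : (0 < J)%N by case: J lt f finj e ei => // ? ? ? [] ?; rewrite muln0.
exists (Ordinal (ltn_pmod e J0)); apply: val_inj => /=.
by rewrite -ei -divn_eq.
Qed.

Section limit_digits.
Context d (T : measurableType d) (R : realType) (P : probability T R).

Lemma uniform_div N n (X : T -> nat) : (n <= N)%N ->
  uniform_below P (2 ^ N) X -> uniform_below P (2 ^ n) (fun x => X x %/ 2 ^ (N - n))%N.
Proof.
move=> nN uX; have NE : (2 ^ N = 2 ^ n * 2 ^ (N - n))%N by rewrite -expnD subnKC.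
have J0 : (0 < 2 ^ (N - n))%N by rewrite expn_gt0.
apply: (uniform_comp (f := fun e => e %/ 2 ^ (N - n))%N uX).
  by move=> e; rewrite NE ltn_divLR.
move=> i iN; rewrite [in X in X / _]NE card_div_fiber// NE natrM invfM mulrA.
by rewrite mulrAC divff ?mul1r// pnatr_eq0 -lt0n.
Qed.

Lemma uniform_perm_below N s s' (X : T -> nat) : perm_below N s s' ->
  uniform_below P N X -> uniform_below P N (s \o X).
Proof.
move=> ss uX; apply: (uniform_comp uX) => [e /ss[]//|i iN].
have [_ s'N _ s'K] := ss i iN.
rewrite (_ : #|_| = 1)%N ?div1r//.
rewrite -(card1 (Ordinal s'N)); apply: eq_card => e; rewrite !inE.
apply/eqP/eqP => [si|->//]; apply: val_inj => /=; rewrite -si.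
by have [] := ss e (ltn_ord e).
Qed.

Context (nn : nat -> nat) (b : nat -> T -> nat) (e : nat -> R).
Hypothesis nnS : forall k, (nn k < nn k.+1)%N.
Hypothesis ub : forall k, uniform_below P (2 ^ nn k) (b k).

Definition jump k := [set x | (b k.+1 x %/ 2 ^ (nn k.+1 - nn k))%N != b k x].

Hypothesis jump_le : forall k, prb P (jump k) <= e k.
Hypothesis e_half : forall k, e k.+1 <= e k / 2.

(** Off this set the digits known at stage [k] are never revised later; its measure is controlled by
    a geometric series. *)
Definition unsettled k := \bigcup_j jump (k + j).

Lemma jump_measurable k : measurable (jump k).
Proof.
have [_ m1 _] := ub k.+1; have [_ m0 _] := ub k.
have := digit_measurable_op (fun p q => nat_of_bool ((p %/ 2 ^ (nn k.+1 - nn k))%N != q)) m1 m0.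
move=> /(digit_measurable_pred (fun k => k == 1%N)); congr measurable.
by apply/seteqP; split=> x /=; rewrite /jump /=; case: (_ != _).
Qed.

Lemma unsettled_measurable k : measurable (unsettled k).
Proof. by apply: bigcupT_measurable => j; exact: jump_measurable. Qed.

Lemma e_geo k j : e (k + j) <= e k / (2 ^ j)%:R.
Proof.
elim: j => [|j IH]; first by rewrite addn0 expn0 divr1.
rewrite addnS (le_trans (e_half _))// expnS natrM invfM mulrCA mulrC ler_pM2l//.
Qed.

Lemma unsettled_prb k : prb P (unsettled k) <= 2 * e k.
Proof.
have e0 : 0 <= e k by exact: le_trans (prb_ge0 P _) (jump_le k).
apply: prb_bigcup_geo => [|j|j]; first by rewrite mulr_ge0.
  exact: jump_measurable.
apply: le_trans (jump_le _) _; apply: le_trans (e_geo k j) _.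
rewrite expnS natrM le_eqVlt; apply/orP; left; apply/eqP; field.
by rewrite pnatr_eq0 -lt0n expn_gt0.
Qed.

Lemma unsettled_le k j : (k <= j)%N -> unsettled j `<=` unsettled k.
Proof.
by move=> /subnKC <- x [i _ xi]; exists (j - k + i)%N => //; rewrite addnA.
Qed.

Lemma nn_le k j : (k <= j)%N -> (nn k <= nn j)%N.
Proof.
elim: j => [|j IH]; first by rewrite leqn0 => /eqP ->.
by rewrite leq_eqVlt => /predU1P[->//|/IH /leq_trans]; apply; exact: ltnW.
Qed.

Lemma nn_ge k : (k <= nn k)%N.
Proof. by elim: k => // k IH; exact: leq_ltn_trans IH (nnS k). Qed.

Lemma settled k j x : (k <= j)%N -> ~ unsettled k x ->
  (b j x %/ 2 ^ (nn j - nn k))%N = b k x.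
Proof.
move=> + nx; elim: j => [|j IH]; first by rewrite leqn0 => /eqP ->; rewrite subnn divn1.
rewrite leq_eqVlt => /predU1P[->|]; first by rewrite subnn divn1.
rewrite ltnS => kj; rewrite -(IH kj).
have -> : (nn j.+1 - nn k = (nn j.+1 - nn j) + (nn j - nn k))%N.
  by have := nn_le kj; have := nnS j; lia.
rewrite expnD divnMA; congr (_ %/ _)%N; apply: contrapT => /eqP ne; apply: nx.
by exists (j - k)%N => //; rewrite subnKC.
Qed.

Definition settling_time x := xget 0%N [set k | ~ unsettled k x].

(** Points that never settle form a null set and receive the digits 0, which keeps all levels
    compatible everywhere. The maximum with [n] guarantees that at least [n] digits are available,
    because [nn k] is at least [k]. *)
Definition limit_digit n x : nat :=
  if `[< exists k, ~ unsettled k x >] then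
    let k := maxn (settling_time x) n in (b k x %/ 2 ^ (nn k - n))%N
  else 0%N.

Lemma limit_digitE k n x : ~ unsettled k x -> (n <= nn k)%N ->
  limit_digit n x = (b k x %/ 2 ^ (nn k - n))%N.
Proof.
move=> nx nk; rewrite /limit_digit; case: asboolP => [_|[]]; last by exists k.
have ns : ~ unsettled (settling_time x) x.
  by rewrite /settling_time; case: xgetP => [j _|/(_ k)] //; exact.
set K := maxn _ n; have nK : ~ unsettled K x.
  by move=> /(unsettled_le (leq_maxl _ _)).
have E j : ~ unsettled j x -> (n <= nn j)%N -> (j <= maxn K k)%N ->
    (b j x %/ 2 ^ (nn j - n) = b (maxn K k) x %/ 2 ^ (nn (maxn K k) - n))%N.
  move=> nj jn jM; rewrite -(settled jM nj) -divnMA -expnD.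
  by congr (_ %/ 2 ^ _)%N; have := nn_le jM; lia.
rewrite /= (E k)// ?leq_maxr// (E K)// ?leq_maxl//.
by rewrite (leq_trans (leq_maxr (settling_time x) n))// nn_ge.
Qed.

Lemma limit_digit_measurable n : digit_measurable (limit_digit n).
Proof.
move=> i; pose F k := ~` unsettled k `&` [set x | (b k x %/ 2 ^ (nn k - n))%N = i].
have mF k : measurable (F k).
  apply: measurableI; first by apply: measurableC; exact: unsettled_measurable.
  by have [_ mb _] := ub k; exact: (digit_measurable_comp (fun a => a %/ 2 ^ (nn k - n))%N mb).
(* The points that never settle carry the default digit 0, so they belong to the fibre over 0
   alone. *)
pose N := if i == 0%N then \bigcap_k unsettled k else set0.
rewrite [X in measurable X](_ : _ = (\bigcup_(k in [set k | (n <= k)%N]) F k) `|` N).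
  apply: measurableU; first by apply: bigcup_measurable => k _; exact: mF.
  rewrite /N; case: eqP => // _.
  by apply: bigcapT_measurable => k; exact: unsettled_measurable.
apply/seteqP; split=> x /=.
- have [[k nk]|nex] := pselect (exists k, ~ unsettled k x).
    have nK : ~ unsettled (maxn k n) x by move=> /(unsettled_le (leq_maxl _ _)).
    move=> di; left; exists (maxn k n) => /=; first exact: leq_maxr.
    by split=> //=; rewrite -di (limit_digitE nK)// (leq_trans (leq_maxr k n))// nn_ge.
  rewrite /limit_digit; case: asboolP => [/nex//|_ i0]; right; rewrite /N -i0 eqxx => k _.
  by apply: contrapT => nk; apply: nex; exists k.
- move=> [[k /= nk [nx bi]]|].
    by rewrite -bi (limit_digitE nx)// (leq_trans nk)// nn_ge.
  rewrite /N; case: eqP => // i0 ux; rewrite i0.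
  rewrite /limit_digit; case: asboolP => // -[k]; case; exact: ux.
Qed.

Lemma e_small r : 0 < r -> exists k, forall j, (k <= j)%N -> 2 * e j <= r.
Proof.
move=> r0; have e0 k : 0 <= e k by exact: le_trans (prb_ge0 P _) (jump_le k).
exists (Num.truncn (r^-1 * (2 * e 0))) => j kj.
have := e_geo 0 j; rewrite add0n => ej.
apply: (@le_trans _ _ (2 * (e 0 / (2 ^ j)%:R))); first by rewrite ler_pM2l.
rewrite mulrA ler_pdivrMr ?ltr0n ?expn_gt0// -ler_pdivrMl//.
apply: le_trans (ltW (truncnS_gt _)) _; rewrite ler_nat.
exact: leq_ltn_trans kj (ltn_expl j (ltnSn 1)).
Qed.

(** Every stage has uniformly distributed digits and differs from the limit on a set of measure at
    most [2 * e k]. As this tends to 0, each cell of the limit has exactly the uniform measure. *)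
Lemma limit_digits : dyadic_digits P limit_digit.
Proof.
have lt n x : (limit_digit n x < 2 ^ n)%N.
  rewrite /limit_digit; case: asboolP => _; last by rewrite expn_gt0.
  have [lt _ _] := ub (maxn (settling_time x) n).
  rewrite ltn_divLR ?expn_gt0// -expnD subnKC//.
  by rewrite (leq_trans (leq_maxr (settling_time x) n))// nn_ge.
split=> [n|n x]; last first.
  have [[k nk]|nex] := pselect (exists k, ~ unsettled k x); last first.
    by rewrite /limit_digit; case: asboolP => [/nex//|_].
  have nK : ~ unsettled (maxn k n.+1) x by move=> /(unsettled_le (leq_maxl _ _)).
  have nKn := leq_trans (leq_maxr k n.+1) (nn_ge _).
  rewrite !(limit_digitE nK)//; last exact: ltnW.
  rewrite -divn2 -divnMA -expnSr; congr (_ %/ 2 ^ _)%N.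
  by move: nKn; lia.
split=> [||i iN]; [exact: lt|exact: limit_digit_measurable|].
have u k : (n <= k)%N -> uniform_below P (2 ^ n) (fun x => b k x %/ 2 ^ (nn k - n))%N.
  by move=> nk; apply: uniform_div; [exact: leq_trans nk (nn_ge k)|exact: ub].
have close r : 0 < r -> `|prb P [set x | limit_digit n x = i] - (2 ^ n)%:R^-1| <= r.
  move=> r0; have [k hk] := e_small r0.
  have {hk} ek := hk (maxn k n) (leq_maxl _ _).
  have [_ mbK PK] := u (maxn k n) (leq_maxr _ _).
  rewrite -(PK i iN); have mu := unsettled_measurable (maxn k n).
  have ml := limit_digit_measurable n i.
  have nKn := leq_trans (leq_maxr k n) (nn_ge _).
  have h1 := prb_leU P ml (mbK i) mu.
  have h2 := prb_leU P (mbK i) ml mu.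
  have := le_trans (unsettled_prb (maxn k n)) ek.
  rewrite ler_distl lerBlDr => up; apply/andP; split.
    apply: le_trans (h2 _) _; last by rewrite lerD2l.
    move=> x bi; have [|nx] := pselect (unsettled (maxn k n) x); [by right|left].
    by rewrite /= (limit_digitE nx).
  apply: le_trans (h1 _) _; last by rewrite lerD2l.
  move=> x /= bi; have [|nx] := pselect (unsettled (maxn k n) x); [by right|left].
  by rewrite /= -(limit_digitE nx).
apply/eqP; rewrite -subr_eq0 -normr_eq0 eq_le normr_ge0 andbT.
by apply/ler_addgt0Pr => r r0; rewrite add0r; exact: close.
Qed.

End limit_digits.

(** * From almost everywhere inverses to invertible maps *)

Section almost_invertible.
Context d (T : measurableType d) (R : realType) (P : probability T R).

(** [imp_map] asks for an inverse at every point. The null set [N] where inversion fails is enlarged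
    to the null set [B] of points that some iterate of [f] or [g] sends into [N]. The complement of
    [B] is stable under both maps, and on [B] both are replaced by the identity. *)
Lemma ae_inverse_imp (f g : T -> T) :
  measurable_fun setT f -> measurable_fun setT g ->
  (forall A, measurable A -> P (f @^-1` A) = P A) ->
  (forall A, measurable A -> P (g @^-1` A) = P A) ->
  (\forall x \ae P, g (f x) = x) -> (\forall x \ae P, f (g x) = x) ->
  exists F : imp_map P, \forall x \ae P, F x = f x.
Proof.
move=> mf mg fP gP [N1 [mN1 N10 gf]] [N2 [mN2 N20 fg]].
pose N := N1 `|` N2; have mN : measurable N by exact: measurableU.
have N0 : P N = 0%E by rewrite null_set_setU.
have gfN x : ~ N x -> g (f x) = x by move=> nN; apply: contrapT => /gf ?; apply: nN; left.
have fgN x : ~ N x -> f (g x) = x by move=> nN; apply: contrapT => /fg ?; apply: nN; right.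
have pre (h : T -> T) A : measurable_fun setT h -> measurable A -> measurable (h @^-1` A).
  by move=> mh mA; rewrite -[_ @^-1` _]setTI; exact: mh.
have iter_null (h : T -> T) : measurable_fun setT h ->
    (forall A, measurable A -> P (h @^-1` A) = P A) ->
    forall n, measurable (iter n h @^-1` N) /\ P (iter n h @^-1` N) = 0%E.
  move=> mh hP; elim=> [//|n [mI I0]].
  rewrite (_ : iter n.+1 h @^-1` N = h @^-1` (iter n h @^-1` N)).
    by split; [exact: pre|rewrite hP].
  by apply/funext => x /=; rewrite /preimage /= -iterS iterSr.
pose B := \bigcup_n (iter n f @^-1` N `|` iter n g @^-1` N).
have mB : measurable B.
  apply: bigcupT_measurable => n; have [mfn _] := iter_null f mf fP n.
  by have [mgn _] := iter_null g mg gP n; exact: measurableU.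
have B0 : P B = 0%E.
  apply/eqP; rewrite eq_le measure_ge0 andbT.
  have BP : P.-negligible B.
    apply: negligible_bigcup => n; have [mfn f0] := iter_null f mf fP n.
    have [mgn g0] := iter_null g mg gP n.
    by apply/negligibleP; [exact: measurableU|exact: null_set_setU].
  by rewrite (measure_negligible mB BP).
have BN x : ~ B x -> ~ N x by move=> nB Nx; apply: nB; exists 0%N => //; left.
have fB x : ~ B x -> ~ B (f x).
  move=> nB [n _ [|]]; rewrite /preimage /=.
    by rewrite -iterSr => h; apply: nB; exists n.+1 => //; left.
  case: n => [|n] h; first by apply: nB; exists 1%N => //; left.
  have {}h : N (iter n g (g (f x))) by rewrite -iterSr.
  by rewrite (gfN _ (BN _ nB)) in h; apply: nB; exists n => //; right.
have gB x : ~ B x -> ~ B (g x).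
  move=> nB [n _ [|]]; rewrite /preimage /=; last first.
    by rewrite -iterSr => h; apply: nB; exists n.+1 => //; right.
  case: n => [|n] h; first by apply: nB; exists 1%N => //; right.
  have {}h : N (iter n f (f (g x))) by rewrite -iterSr.
  by rewrite (fgN _ (BN _ nB)) in h; apply: nB; exists n => //; left.
pose fix_ (h : T -> T) x := if `[< B x >] then x else h x.
have fixpre h A : fix_ h @^-1` A = (B `&` A) `|` (h @^-1` A `\` B).
  apply/seteqP; split=> x; rewrite /preimage /= /fix_; case: asboolP => Bx.
  - by left.
  - by right.
  - by move=> [[]|[_]].
  - by move=> [[]|[]].
have mfix h : measurable_fun setT h -> measurable_fun setT (fix_ h).
  move=> mh _ A mA; rewrite setTI fixpre; apply: measurableU.
    exact: measurableI.
  by apply: measurableD => //; exact: pre.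
have fixP h A : measurable_fun setT h -> (forall A, measurable A -> P (h @^-1` A) = P A) ->
    measurable A -> P (fix_ h @^-1` A) = P A.
  move=> mh hP mA; rewrite -(hP A mA); apply: prb_squeeze.
  - by rewrite -[_ @^-1` _]setTI; exact: mfix.
  - exact: pre.
  - apply: (subset_measure0 _ mB _ B0).
      apply: measurableU; apply: measurableD; try exact: pre;
        by rewrite -[_ @^-1` _]setTI; exact: mfix.
    move=> x; rewrite /setY /preimage /= /fix_; case: asboolP => // _; tauto.
have fixK (h k : T -> T) : (forall x, ~ B x -> ~ B (h x)) ->
    (forall x, ~ N x -> k (h x) = x) -> cancel (fix_ h) (fix_ k).
  move=> hB khN x; rewrite /fix_; case: (asboolP (B x)) => Bx; first by rewrite (asboolT Bx).
  by rewrite (asboolF (hB x Bx)); exact: khN (BN _ Bx).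
have FP : invertible_measure_preserving P (fix_ f).
  split; [exact: mfix|by move=> A; exact: fixP|].
  exists (fix_ g); split; [exact: fixK|exact: fixK|].
  exact: mfix.
exists (ImpMap FP); exists B; split=> // x /= h; apply: contrapT => nB; apply: h.
by rewrite /fix_ (asboolF nB).
Qed.

End almost_invertible.

Section limit_map.
Context d (T : measurableType d) (R : realType) (P : probability T R).
Variables (c : nat -> T -> nat) (cod : dyadic_coding P c).
Context (nn : nat -> nat) (s s' : nat -> nat -> nat) (e : nat -> R).
Hypothesis nnS : forall k, (nn k < nn k.+1)%N.
Hypothesis ss : forall k, perm_below (2 ^ nn k) (s k) (s' k).
Hypothesis e_half : forall k, e k.+1 <= e k / 2.

Let coded (r : nat -> nat -> nat) k := r k \o c (nn k).

Hypothesis jump_le : forall k, prb P (jump nn (coded s) k) <= e k.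

Let coded_uniform r r' k : perm_below (2 ^ nn k) (r k) (r' k) ->
  uniform_below P (2 ^ nn k) (coded r k).
Proof. by move=> h; apply: uniform_perm_below h _; have [u _] := coding_digits cod. Qed.

(** The injection [a] to [s' k.+1 a] sends cells where [s'] jumps to cells where [s] jumps: if [s]
    does not jump at [s' k.+1 a], applying [s' k] shows that [s'] does not jump at [a]. *)
Lemma jump_inverse_le k : prb P (jump nn (coded s') k) <= e k.
Proof.
apply: le_trans (jump_le k).
set J := (nn k.+1 - nn k)%N.
have cE x : c (nn k) x = (c (nn k.+1) x %/ 2 ^ J)%N by exact: (code_div cod _ (ltnW (nnS k))).
have [u _] := coding_digits cod.
have jE r : prb P (jump nn (coded r) k) =
    #|[pred a : 'I_(2 ^ nn k.+1) | r k.+1 a %/ 2 ^ J != r k (a %/ 2 ^ J)]%N|%:R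
    / (2 ^ nn k.+1)%:R.
  rewrite -(uniform_prb (fun a => (r k.+1 a %/ 2 ^ J)%N != r k (a %/ 2 ^ J)%N) (u _)).
  by congr (prb P _); apply/seteqP; split=> x; rewrite /jump /coded /= cE.
rewrite !jE ler_pM2r ?invr_gt0 ?ltr0n ?expn_gt0// ler_nat.
have lt (a : 'I_(2 ^ nn k.+1)) : (s' k.+1 a < 2 ^ nn k.+1)%N by have [] := @ss k.+1 _ (ltn_ord a).
have finj : injective (fun a => Ordinal (lt a)).
  move=> a b [ab]; have [_ _ _ sa] := @ss k.+1 _ (ltn_ord a).
  by have [_ _ _ sb] := @ss k.+1 _ (ltn_ord b); apply: val_inj; rewrite /= -sa ab sb.
rewrite -(fintype.card_image finj); apply: subset_leq_card.
apply/fintype.subsetP => _ /fintype.imageP[a + ->].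
rewrite !inE /=; apply: contra => /eqP; have [_ _ _ ->] := @ss k.+1 _ (ltn_ord a).
have lt2 : (s' k.+1 a %/ 2 ^ J < 2 ^ nn k)%N.
  by rewrite ltn_divLR ?expn_gt0// -expnD subnKC// ltnW.
by move=> ->; have [_ _ -> _] := @ss k _ lt2.
Qed.

(** The limit digits of [s] alone give a measure-preserving map; those of [s'] give its inverse
    almost everywhere. Up to a null set the mismatch at stage [k] lies in the unsettled set of that
    stage. *)
Lemma limit_map : exists F : imp_map P,
  forall k, prb P (mismatch c (nn k) (s k) F) <= 2 * e k.
Proof.
have us k : uniform_below P (2 ^ nn k) (coded s k) by exact: coded_uniform (@ss k).
have us' k : uniform_below P (2 ^ nn k) (coded s' k).
  exact: coded_uniform (perm_below_sym (@ss k)).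
have D := limit_digits nnS us jump_le e_half.
have D' := limit_digits nnS us' jump_inverse_le e_half.
have [f [mf fP fc]] := coding_realize cod D.
have [g [mg gP gc]] := coding_realize cod D'.
have [T1 [mT1 T10 sep]] := coding_separate cod.
have pre (h : T -> T) A : measurable_fun setT h -> measurable A -> measurable (h @^-1` A).
  by move=> mh mA; rewrite -[_ @^-1` _]setTI; exact: mh.
have pull (h : T -> T) (Q : T -> Prop) : measurable_fun setT h ->
    (forall A, measurable A -> P (h @^-1` A) = P A) ->
    (\forall x \ae P, Q x) -> \forall x \ae P, Q (h x).
  move=> mh hP [N [mN N0 QN]]; exists (h @^-1` N); split; first exact: pre.
    by rewrite hP.
  by move=> x /= nQ; apply: QN.
have settle r (ur : forall k, uniform_below P (2 ^ nn k) (coded r k)) :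
    (forall k, prb P (jump nn (coded r) k) <= e k) ->
    \forall x \ae P, exists k, ~ unsettled nn (coded r) k x.
  move=> jr; have mu k := unsettled_measurable ur k.
  exists (\bigcap_k unsettled nn (coded r) k); split.
  - by apply: bigcapT_measurable.
  - apply: prb0P; first exact: bigcapT_measurable.
    move=> q q0; have [k ek] := e_small jr e_half q0.
    apply: le_trans (ek k (leqnn k)); apply: le_trans (unsettled_prb ur jr e_half k).
    by apply: prb_le => //; [exact: bigcapT_measurable|exact: bigcap_inf].
  - by move=> x /= nx k _; apply: contrapT => nk; apply: nx; exists k.
have T1ae : \forall x \ae P, T1 x.
  by exists (~` T1); split => //; exact: measurableC.
have inverse r r' (h h' : T -> T)
    (ur : forall k, uniform_below P (2 ^ nn k) (coded r k))
    (ur' : forall k, uniform_below P (2 ^ nn k) (coded r' k)) :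
    (forall k, perm_below (2 ^ nn k) (r k) (r' k)) ->
    (forall k, prb P (jump nn (coded r) k) <= e k) ->
    (forall k, prb P (jump nn (coded r') k) <= e k) ->
    measurable_fun setT h -> measurable_fun setT h' ->
    (forall A, measurable A -> P (h @^-1` A) = P A) ->
    (forall A, measurable A -> P (h' @^-1` A) = P A) ->
    (\forall x \ae P, forall n, c n (h x) = limit_digit nn (coded r) n x) ->
    (\forall x \ae P, forall n, c n (h' x) = limit_digit nn (coded r') n x) ->
    \forall x \ae P, h' (h x) = x.
  move=> rr jr jr' mh mh' hP h'P hc h'c.
  have A1 := pull h _ mh hP h'c; have A2 := pull h _ mh hP (settle r' ur' jr').
  have A3 := pull h _ mh hP (pull h' _ mh' h'P T1ae).
  apply: filterS2 (filterI hc (filterI (settle r ur jr) T1ae)) (filterI A1 (filterI A2 A3)).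
  move=> x [hx [[k1 nk1] Tx]] [h'x [[k2 nk2] Thx]].
  (* At a stage where both [x] and [h x] are settled, [h] acts on codes as [r k] and [h'] as [r' k],
     which undoes it; [x] and [h' (h x)] thus share all digits. *)
  apply: sep => // n; pose k := maxn (maxn k1 k2) n.
  have n1 : ~ unsettled nn (coded r) k x.
    by move=> /(unsettled_le (leq_trans (leq_maxl k1 k2) (leq_maxl _ n))).
  have n2 : ~ unsettled nn (coded r') k (h x).
    by move=> /(unsettled_le (leq_trans (leq_maxr k1 k2) (leq_maxl _ n))).
  have nk : (n <= nn k)%N := leq_trans (leq_maxr _ n) (nn_ge nnS k).
  rewrite !(code_div cod _ nk); congr (_ %/ _)%N.
  rewrite h'x (limit_digitE nnS n2)// subnn divn1 /coded /= hx.
  rewrite (limit_digitE nnS n1)// subnn divn1 /coded /=.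
  by have [_ _ -> _] := rr k (c (nn k) x) (code_lt cod _ _).
have gf : \forall x \ae P, g (f x) = x.
  exact: (inverse s s' f g us us' (fun k => @ss k) jump_le jump_inverse_le).
have fg : \forall x \ae P, f (g x) = x.
  by apply: (inverse s' s g f us' us _ jump_inverse_le jump_le) => // k; exact: perm_below_sym.
have [F Ff] := ae_inverse_imp mf mg fP gP gf fg.
exists F => k; apply: le_trans (unsettled_prb us jump_le e_half k).
have [N [mN N0 FN]] : \forall x \ae P, F x = f x /\
    forall n, c n (f x) = limit_digit nn (coded s) n x.
  exact: filterI Ff fc.
have mm := mismatch_measurable cod (nn k) (s k) (imp_measurable_fun F).
have mu := unsettled_measurable us k.
have -> : prb P (unsettled nn (coded s) k) = prb P (unsettled nn (coded s) k) + prb P N.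
  by rewrite /prb N0 addr0.
apply: prb_leU => // x mx; have [|nx] := pselect (unsettled nn (coded s) k x); [by left|right].
apply: FN => -[Fx fx]; move/eqP: mx; apply.
by rewrite Fx fx (limit_digitE nnS nx)// subnn divn1.
Qed.

End limit_map.

(** * Weak neighbourhoods *)

Section weak_neighbourhoods.
Context d (T : measurableType d) (R : realType) (P : probability T R).
Variables (c : nat -> T -> nat) (cod : dyadic_coding P c).

Lemma prb_partition N (X : T -> nat) A : uniform_below P N X -> measurable A ->
  prb P A = \sum_(i < N) prb P (A `&` [set x | X x = i]).
Proof.
move=> [lt mX _] mA; have mAX i : measurable (A `&` [set x | X x = i]).
  by apply: measurableI.
apply: EFin_inj; rewrite -prbE// -sumEFin.
transitivity (P (\big[setU/set0]_(i < N) (A `&` [set x | X x = i]))).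
  congr (P _); rewrite -bigcup_seq; apply/seteqP; split=> [x Ax|x [i _ []//]].
  by exists (Ordinal (lt x)); rewrite //= mem_index_enum.
rewrite measure_bigsetU_ord//.
  by apply: eq_bigr => i _; exact: prbE.
by move=> i j _ _ [x [[_ /= Xi] [_ /= Xj]]]; apply: val_inj; rewrite /= -Xi -Xj.
Qed.

Lemma prb_setD_sym A B : measurable A -> measurable B -> prb P A = prb P B ->
  prb P (B `\` A) = prb P (A `\` B).
Proof.
move=> mA mB AB; have := prb_split P mA mB; have := prb_split P mB mA.
by rewrite setIC; lra.
Qed.

Let D n i := [set x | c n x = i].

Let mD n i : measurable (D n i).
Proof. exact: (code_measurable cod n i). Qed.

Lemma open_mismatch N s (e : R) :
  open [set sigma : maps P | prb P (mismatch c N s sigma) < e].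
Proof.
rewrite weak_openE => tau /= te.
have u : uniform_below P (2 ^ N) (c N) by have [u _] := coding_digits cod.
have splitE (f : maps P) : prb P (mismatch c N s f) =
    \sum_(i < 2 ^ N) prb P (f @` D N i `\` D N (s i)).
  have mf := mismatch_measurable cod N s (imp_measurable_fun (repr f)).
  rewrite (prb_partition u mf); apply: eq_bigr => i _.
  rewrite -(imp_image_prb (repr f)); last first.
    by apply: measurableI; [exact: mf|exact: (mD N i)].
  congr (prb P _); apply/seteqP; split=> y.
    move=> [x [/eqP mx Dx] <-]; rewrite /D /= in Dx; split; first by exists x.
    by rewrite /D /= -Dx.
  move=> [[x Dx fx] nD]; exists x => //; split=> //.
  rewrite /mismatch /=; apply/eqP => cx; apply: nD.
  by rewrite /D /= -fx -[X in s X]Dx.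
pose del := (e - prb P (mismatch c N s tau)) / (2 ^ N)%:R.
have del0 : 0 < del by rewrite divr_gt0 ?subr_gt0// ltr0n expn_gt0.
exists [seq D N (nat_of_ord i) | i <- enum 'I_(2 ^ N)], del; split=> //.
  by move=> A /mapP[i _ ->].
move=> sigma near /=; rewrite splitE.
have imgm (f : maps P) i : measurable (f @` D N i).
  by apply: measurable_maps_image; exact: mD.
apply: (@lt_le_trans _ _ (\sum_(i < 2 ^ N) (prb P (tau @` D N i `\` D N (s i)) + del))).
  have z : (0 < 2 ^ N)%N by rewrite expn_gt0.
  apply: ltr_sum; first by apply/hasP; exists (Ordinal z); rewrite ?mem_index_enum.
  move=> i _; have /near : D N i \in [seq D N (nat_of_ord i) | i <- enum 'I_(2 ^ N)].
    by apply/mapP; exists i; rewrite ?mem_enum.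
  have md : measurable ((sigma @` D N i) `+` (tau @` D N i)).
    by apply: measurableU; apply: measurableD.
  rewrite /weak_dist (prbE P md) lte_fin => lt.
  apply: (@le_lt_trans _ _ (prb P (tau @` D N i `\` D N (s i)) +
    prb P ((sigma @` D N i) `+` (tau @` D N i)))); last by rewrite ltrD2l.
  apply: prb_leU => //; try exact: measurableD.
  move=> y [sy nD]; have [ty|nt] := pselect ((tau @` D N i) y); [by left|by right; left].
rewrite big_split /= -splitE sumr_const card_ord -mulr_natr /del divfK; first by rewrite subrKC.
by rewrite pnatr_eq0 -lt0n expn_gt0.
Qed.

Lemma open_model_pairs m i l : open (model_pairs c m i l : set (maps P * maps P)).
Proof.
pose V := [set q : nat * (nat -> nat) * (nat -> nat) | exists y,
  [/\ (l <= q.1.1)%N, (m <= q.1.1)%N & coherent q.1.1 q.1.2 q.2 m i y]].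
rewrite (_ : model_pairs c m i l = \bigcup_(q in V)
    (fst @^-1` [set sigma : maps P | prb P (mismatch c q.1.1 q.1.2 sigma) < tolerance R q.1.1] `&`
     snd @^-1` [set tau : maps P | prb P (mismatch c q.1.1 q.2 tau) < tolerance R q.1.1])).
  apply: bigcup_open => q _; apply: openI.
    by apply: open_comp; [move=> x _; exact: cvg_fst|exact: open_mismatch].
  by apply: open_comp; [move=> x _; exact: cvg_snd|exact: open_mismatch].
apply/seteqP; split=> st.
  move=> [N [s [t [y [lN mN coh ms mt]]]]].
  by exists ((N, s), t) => //; exists y.
by move=> [[[N s] t] /= [y [lN mN coh]] [ms mt]]; exists N, s, t, y.
Qed.

End weak_neighbourhoods.

Lemma card_ord_count N (Q : pred nat) : #|[pred e : 'I_N | Q e]| = count Q (iota 0 N).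
Proof.
rewrite cardE -val_enum_ord count_map -size_filter enumT.
by rewrite /enum_mem -enumT.
Qed.

(** * Weak approximation by permutations of dyadic cells *)

Section weak_approximation.
Context d (T : measurableType d) (R : realType) (P : probability T R).
Variables (c : nat -> T -> nat) (cod : dyadic_coding P c).

Let u n : uniform_below P (2 ^ n) (c n).
Proof. by have [u _] := coding_digits cod. Qed.

Let mS n (S : pred nat) : measurable [set x | S (c n x)].
Proof. exact: digit_measurable_pred (code_measurable cod n). Qed.

Lemma approx_levels (l : seq (set T)) (e : R) : 0 < e ->
  (forall A, A \in l -> measurable A) -> exists m, forall N, (m <= N)%N ->
  forall A, A \in l -> exists S : pred nat, prb P (A `+` [set x | S (c N x)]) < e.
Proof.
move=> e0; elim: l => [|A l IH] ml; first by exists 0%N => N _ A; rewrite in_nil.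
have [|m hm] := IH; first by move=> B Bl; apply: ml; rewrite inE Bl orbT.
have [n [S hS]] := coding_approx cod (ml A (mem_head _ _)) e0.
exists (maxn m n) => N; rewrite geq_max => /andP[mN nN] B; rewrite inE => /predU1P[->|]; last first.
  exact: hm.
exists (fun a => S (a %/ 2 ^ (N - n))%N); move: hS; congr (prb P (_ `+` _) < _).
by apply/funext => x /=; rewrite (code_div cod x nN).
Qed.

(** The permutation [q] runs backwards, from cells of the target to cells of the source, since cells
    of the target are sorted by the image they mostly belong to; the inverse [q'] is the model of
    [f]. *)
Lemma finite_model (f : imp_map P) m (del : R) : 0 < del ->
  exists n q q', [/\ (m <= n)%N, perm_below (2 ^ n) q q' &
    forall i, (i < 2 ^ m)%N ->
      prb P (f @` [set x | c m x = i] `\`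
             [set y | (q (c n y) %/ 2 ^ (n - m))%N == i]) <= del].
Proof.
move=> del0; pose K := (2 ^ m)%N; pose F i := f @` [set x | c m x = i].
have mF i : measurable (F i) by apply: imp_image_measurable; exact: (code_measurable cod).
(* The [i]-th error is at most [(i + 2) e]: once for [F i] off [S i], [i] times for cells taken by
   smaller labels, once for the cells labelled [i] in excess of [J]. As [i < K], this is at most
   [(K + 1) e]. *)
pose e := del / K.+1%:R; have e0 : 0 < e by rewrite divr_gt0.
have [|n0 hn0] := @approx_levels [seq F i | i <- iota 0 K] e e0.
  by move=> A /mapP[i _ ->]; exact: mF.
pose n := maxn n0 m; pose N := (2 ^ n)%N; pose J := (2 ^ (n - m))%N.
have mn : (m <= n)%N by exact: leq_maxr.
have NE : N = (K * J)%N by rewrite /N /K /J -expnD subnKC.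
have J0 : (0 < J)%N by rewrite expn_gt0.
have /choice[S hS] : forall i, exists S : pred nat, (i < K)%N ->
    prb P (F i `+` [set x | S (c n x)]) < e.
  move=> i; have [iK|_] := boolP (i < K)%N; last by exists xpred0.
  have [|S hS] := hn0 n (leq_maxl _ _) (F i); last by exists S.
  by apply/mapP; exists i; rewrite // mem_iota.
(* Target cells are labelled by the image they mostly belong to; the first J cells
   labelled i are matched with the J cells refining the i-th source cell. *)
pose lab a := find (fun i => S i a) (iota 0 K).
have labS a : (lab a < K)%N -> S (lab a) a.
  move=> la; have : has (fun i => S i a) (iota 0 K) by rewrite has_find size_iota.
  by move=> /(nth_find 0%N); rewrite -/(lab a) nth_iota.
have labmin a i : (i < K)%N -> S i a -> (lab a <= i)%N.
  move=> iK Sia; rewrite leqNgt; apply/negP => il.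
  by have := before_find 0%N il; rewrite nth_iota// add0n Sia.
pose cls i := [seq a <- iota 0 N | lab a == i].
pose rk a := index a (cls (lab a)).
pose A := [set a : 'I_N | (lab a < K)%N && (rk a < J)%N]%SET.
have codeN i j : (i < K)%N -> (j < J)%N -> (i * J + j < N)%N.
  move=> iK jJ; rewrite NE; apply: (@leq_trans (i.+1 * J)); last by rewrite leq_mul2r iK orbT.
  by rewrite mulSn addnC ltn_add2r.
pose g (a : 'I_N) : 'I_N := insubd a (lab a * J + rk a)%N.
have gE (a : 'I_N) : a \in A -> val (g a) = (lab a * J + rk a)%N.
  by rewrite inE => /andP[la ra]; rewrite /g insubdK// unfold_in /=; exact: codeN.
have gdiv (a : 'I_N) : a \in A -> (g a %/ J = lab a)%N.
  move=> aA; rewrite gE// divnMDl//; move: aA; rewrite inE => /andP[_ ra].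
  by rewrite (divn_small ra) addn0.
have ginj : {in A &, injective g}.
  move=> a b aA bA gab; have lab_ab : lab a = lab b by rewrite -!gdiv// gab.
  have : (lab a * J + rk a = lab b * J + rk b)%N by rewrite -!gE// gab.
  rewrite lab_ab => /addnI; rewrite /rk lab_ab => ri; apply: val_inj => /=.
  have ac : (a : nat) \in cls (lab b).
    by rewrite mem_filter lab_ab eqxx mem_iota /=.
  have bc : (b : nat) \in cls (lab b) by rewrite mem_filter eqxx mem_iota /=.
  by rewrite -(nth_index 0%N ac) ri nth_index.
have [p [pg _]] := partial_perm_extend (u := fun=> tt) ginj (fun a _ => erefl).
have [q [q' [qq' qp]]] := perm_below_of_perm p.
exists n, q, q'; split=> // i iK; rewrite -/(F i) -/J.
have cN x : (c n x < N)%N := code_lt cod n x.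
pose Q a := (lab a == i) && (J <= rk a)%N.
have mQ : measurable [set y | (q (c n y) %/ J)%N == i].
  exact: (mS n (fun a => (q a %/ J)%N == i)).
have mE j : measurable ([set x | S j (c n x)] `\` F j) by apply: measurableD.
(* A point of [F i] in a cell with label [j < i] is in [S j], but not in [F j], because the images
   of distinct cells are disjoint. *)
pose E := \big[setU/set0]_(j < i) ([set x | S j (c n x)] `\` F j).
have mbE : measurable E by apply: bigsetU_measurable.
have sub : F i `\` [set y | (q (c n y) %/ J)%N == i] `<=`
    (F i `\` [set x | S i (c n x)]) `|` (E `|` [set x | Q (c n x)]).
  move=> y [Fy nq]; have [Sy|nS] := boolP (S i (c n y)); last by left; split=> //; exact/negP.
  right; have := labmin _ _ iK Sy; rewrite leq_eqVlt => /orP[/eqP li|li].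
    right; rewrite /= /Q li eqxx leqNgt; apply/negP => ra; apply: nq => /=.
    have aA : Ordinal (cN y) \in A by rewrite inE /= li iK.
    by have := qp (Ordinal (cN y)); rewrite pg// => ->; rewrite gdiv//= li.
  left; rewrite /E -bigcup_seq; exists (Ordinal li); first by rewrite /= mem_index_enum.
  split; first exact: labS (ltn_trans li iK).
  move: Fy => [x /= cx fx] [x' /= cx' fx']; have [f' [ff' _ _]] := imp_inverse f.
  have xx' : x = x' by apply: (can_inj ff'); rewrite fx fx'.
  by move: li; rewrite -cx xx' cx' ltnn.
have b1 j : (j < K)%N -> prb P (F j `\` [set x | S j (c n x)]) <= e /\
    prb P ([set x | S j (c n x)] `\` F j) <= e.
  move=> jK; have := ltW (hS j jK); have mY : measurable (F j `+` [set x | S j (c n x)]).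
    by apply: measurableU; exact: measurableD.
  by move=> le; split; apply: le_trans le; apply: prb_le => //;
    try exact: measurableD; move=> x; [left|right].
have b2 : prb P E <= i%:R * e.
  apply: le_trans (prb_bigU P _ (fun j : 'I_i => mE j)) _.
  have -> : i%:R * e = \sum_(j < i) e by rewrite sumr_const card_ord mulr_natl.
  apply: ler_sum => j _; exact: (b1 j (ltn_trans (ltn_ord j) iK)).2.
have PF : prb P (F i) = J%:R / N%:R.
  rewrite /F imp_image_prb; last exact: (code_measurable cod).
  have [_ _ ->] := u m; last exact: iK.
  by rewrite -/K NE natrM invfM mulrCA divff ?mulr1// pnatr_eq0 -lt0n.
have N0 : (0 : R) < N%:R by rewrite ltr0n expn_gt0.
(* Cells labelled [i] lie in [S i], so their measure is at most that of [F i], namely [J / N], plus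
   [e]; whatever exceeds [J] cells has measure at most [e]. *)
have b3 : prb P [set x | Q (c n x)] <= e.
  have szcls : (size (cls i))%:R / N%:R <= J%:R / N%:R + e.
    rewrite size_filter -(card_ord_count N (fun a => lab a == i)).
    rewrite -(uniform_prb (fun a => lab a == i) (u n)) -PF.
    apply: (@le_trans _ _ (prb P (F i `|` ([set x | S i (c n x)] `\` F i)))).
      apply: prb_le; [exact: (mS n (fun a => lab a == i))|exact: measurableU|].
      move=> x /= /eqP li; have Sx : S i (c n x) by rewrite -li; apply: labS; rewrite li.
      by have [Fx|nF] := pselect (F i x); [left|right].
    by apply: le_trans (prbU P (mF i) (mE i)) _; rewrite lerD2l; exact: (b1 i iK).2.
  rewrite (uniform_prb Q (u n)) -/N.
  have [small|large] := leqP (size (cls i)) J.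
    rewrite eq_card0 ?mul0r ?ltW// => a; rewrite !inE /Q; apply/negP => /andP[/eqP la Ja].
    have : (rk a < size (cls i))%N by rewrite /rk la index_mem mem_filter la eqxx mem_iota /=.
    by move=> /leq_trans/(_ small); rewrite ltnNge Ja.
  have cardQ : (#|[pred a : 'I_N | Q a]| <= size (cls i) - J)%N.
    pose h (a : 'I_N) := (rk a - J)%N.
    have hinj : {in [pred a : 'I_N | Q a] &, injective h}.
      move=> a b; rewrite !inE /Q /h => /andP[/eqP la Ja] /andP[/eqP lb Jb].
      move=> /(congr1 (addn^~ J)); rewrite !subnK// /rk la lb => ri.
      have ac : (a : nat) \in cls i by rewrite mem_filter la eqxx mem_iota /=.
      have bc : (b : nat) \in cls i by rewrite mem_filter lb eqxx mem_iota /=.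
      by apply: val_inj; rewrite /= -(nth_index 0%N ac) ri nth_index.
    rewrite cardE -(size_map h) -[leqRHS](size_iota 0); apply: uniq_leq_size.
      rewrite map_inj_in_uniq ?enum_uniq// => a b; rewrite !mem_enum; exact: hinj.
    move=> z /mapP[a]; rewrite mem_enum inE /Q => /andP[/eqP la Ja] ->.
    rewrite mem_iota add0n /= /h ltn_sub2r//.
    by rewrite /rk la index_mem mem_filter la eqxx mem_iota /=.
  apply: (@le_trans _ _ ((size (cls i) - J)%:R / N%:R)).
    by rewrite ler_pM2r ?invr_gt0// ler_nat.
  by rewrite natrB ?(ltnW large)// mulrBl lerBlDl.
have iK' : i%:R + 2 <= (K.+1)%:R :> R by rewrite -natrD ler_nat addn2 !ltnS.
apply: le_trans (prb_leU P _ _ _ sub) _.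
- exact: measurableD.
- exact: measurableD.
- by apply: measurableU => //; exact: (mS n Q).
apply: le_trans (lerD (b1 i iK).1 (prbU P mbE (mS n Q))) _.
apply: (@le_trans _ _ (K.+1%:R * e)); last by rewrite /e mulrCA divff ?mulr1.
apply: (@le_trans _ _ ((i%:R + 2) * e)); last by rewrite ler_pM2r.
by move: b2 b3; lra.
Qed.

End weak_approximation.

(** * Density of the generic pairs *)

Section generic_pairs.
Context d (T : measurableType d) (R : realType) (P : probability T R).
Variables (c : nat -> T -> nat) (cod : dyadic_coding P c).

Let u n : uniform_below P (2 ^ n) (c n).
Proof. by have [u _] := coding_digits cod. Qed.

Let mc n i : measurable [set x | c n x = i].
Proof. exact: (code_measurable cod). Qed.

(** A map that mostly follows [q'] sends each cell [D i] close to the set [Q i], and [sigma] does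
    the same. The two maps are thus compared through [Q i], after replacing each test set by a union
    of cells. *)
Lemma weak_nbhd_model (sigma : maps P) (U : set (maps P)) : open U -> U sigma ->
  exists n q q' (e : R), [/\ perm_below (2 ^ n) q q', 0 < e &
    forall sigma' : maps P, prb P (mismatch c n q sigma') < e -> U sigma'].
Proof.
rewrite weak_openE => oU /oU[l [r [ml r0 lU]]].
have r6 : 0 < r / 6 by lra.
have [m hm] := approx_levels cod r6 ml; pose K := (2 ^ m)%N.
have K0 : (0 : R) < K%:R by rewrite ltr0n expn_gt0.
(* Budget: [r / 6] for each map when [A] is replaced by [B], and [2 * del] for each of [K] cells and
   each map, [r / 3] in all; the total 2r/3 is below [r]. *)
pose del := r / (12 * K%:R).
have del0 : 0 < del by rewrite divr_gt0// mulr_gt0.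
have delE : K%:R * (4 * del) = r / 3 by rewrite /del; field; rewrite gt_eqF.
have [n [q [q' [mn qq' hq]]]] := finite_model cod (repr sigma) m del0.
exists n, q', q, del; split=> //; first exact: perm_below_sym.
move=> sigma' near'; apply: lU => A Al.
have mA := ml A Al; have [S hS] := hm m (leqnn m) A Al.
pose B := [set x | S (c m x)]; have mB : measurable B.
  exact: (digit_measurable_pred S (code_measurable cod m)).
pose Q i := [set y | (q (c n y) %/ 2 ^ (n - m))%N == i].
have mQ i : measurable (Q i).
  exact: (digit_measurable_pred (fun a => (q a %/ 2 ^ (n - m))%N == i) (code_measurable cod n)).
have mim (f : maps P) C : measurable C -> measurable (f @` C).
  exact: measurable_maps_image.
have pim (f : maps P) C : measurable C -> prb P (f @` C) = prb P C.
  exact: (imp_image_prb (repr f)).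
pose D i := [set x | c m x = i].
have PQ i : (i < K)%N -> prb P (Q i) = K%:R^-1.
  move=> iK; have [_ _ h] := uniform_div mn (uniform_perm_below qq' (u n)).
  rewrite -(h i iK).
  by congr (prb P _); apply/seteqP; split=> y /= /eqP.
have PD (f : maps P) i : (i < K)%N -> prb P (f @` D i) = K%:R^-1.
  by move=> iK; rewrite pim ?/D//; have [_ _ h] := u m; exact: h.
have near_Q (f : maps P) i : (i < K)%N -> prb P (f @` D i `\` Q i) <= del ->
    prb P ((f @` D i) `+` Q i) <= 2 * del.
  move=> iK fQ; have mfD := mim f _ (mc m i).
  (* Both sets have measure [1 / K], so the two halves of their symmetric difference are equally
     large. *)
  have QD : prb P (Q i `\` f @` D i) <= del.
    by rewrite (prb_setD_sym mfD (mQ i)) ?PQ ?PD.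
  have := prbU P (measurableD mfD (mQ i)) (measurableD (mQ i) mfD); rewrite /setY; lra.
have sQ i : (i < K)%N -> prb P ((sigma @` D i) `+` Q i) <= 2 * del.
  by move=> iK; apply: near_Q => //; exact: hq.
have mm := mismatch_measurable cod n q' (imp_measurable_fun (repr sigma')).
have sQ' i : (i < K)%N -> prb P ((sigma' @` D i) `+` Q i) <= 2 * del.
  move=> iK; apply: near_Q => //; apply: le_trans (ltW near').
  rewrite -(pim sigma' _ mm); apply: prb_le; [|exact: mim mm|].
    by apply: measurableD; [apply: mim; exact: mc|exact: mQ].
  move=> y [[x Dx xy] nQ]; exists x => //; apply/eqP => cx; apply: nQ.
  rewrite /Q /= -xy cx; have [_ _ _ ->] := qq' _ (code_lt cod n x).
  by rewrite -(code_div cod x mn) Dx.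
have mAB : measurable (A `+` B) by apply: measurableU; exact: measurableD.
have mDQ (f : maps P) i : measurable ((f @` D i) `+` Q i).
  have := mim f _ (mc m i) => mfD.
  by apply: measurableU; exact: measurableD.
pose G (f : maps P) := \big[setU/set0]_(i < K) ((f @` D i) `+` Q i).
have mG f : measurable (G f) by apply: bigsetU_measurable.
have GP (f : maps P) : (forall i, (i < K)%N -> prb P ((f @` D i) `+` Q i) <= 2 * del) ->
    prb P (G f) <= K%:R * (2 * del).
  move=> fQ; apply: le_trans (prb_bigU P _ (fun i : 'I_K => mDQ f i)) _.
  have -> : K%:R * (2 * del) = \sum_(i < K) (2 * del) by rewrite sumr_const card_ord mulr_natl.
  by apply: ler_sum => i _; exact: fQ.
have half (f g : maps P) : f @` A `\` g @` A `<=`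
    (f @` (A `+` B) `|` g @` (A `+` B)) `|` (G f `|` G g).
  move=> y [[x Ax xy] nA].
  have [Bx|nB] := pselect (B x); last first.
    by left; left; exists x => //; left.
  have GI (h : maps P) : (h @` D (c m x) `+` Q (c m x)) y -> G h y.
    move=> hy; rewrite /G -bigcup_seq; exists (Ordinal (code_lt cod m x)) => //=.
    by rewrite mem_index_enum.
  have fy : (f @` D (c m x)) y by exists x.
  have [Qy|nQ] := pselect (Q (c m x) y); last by right; left; apply: GI; left.
  have [[z Dz zy]|ng] := pselect ((g @` D (c m x)) y); last by right; right; apply: GI; right.
  left; right; exists z => //; right; split; first by rewrite /B /= Dz.
  by move=> Az; apply: nA; exists z.
have sub : (sigma' @` A) `+` (sigma @` A) `<=`
    (sigma' @` (A `+` B) `|` sigma @` (A `+` B)) `|` (G sigma' `|` G sigma).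
  by move=> y [/half|/half[[|]|[|]]]//; [left; right|left; left|right; right|right; left].
have mAA : measurable ((sigma' @` A) `+` (sigma @` A)).
  by apply: measurableU; apply: measurableD; exact: mim.
rewrite /weak_dist (prbE P mAA) lte_fin.
have m1 := measurableU _ _ (mim sigma' _ mAB) (mim sigma _ mAB).
have m2 := measurableU _ _ (mG sigma') (mG sigma).
apply: le_lt_trans (prb_leU P mAA m1 m2 sub) _.
have := prbU P (mim sigma' _ mAB) (mim sigma _ mAB).
have := prbU P (mG sigma') (mG sigma); rewrite !pim//.
by move: (GP _ sQ) (GP _ sQ') hS delE; rewrite -/B; lra.
Qed.

Lemma mismatch_lift n N q (f : T -> T) : (n <= N)%N ->
  mismatch c n q f `<=` mismatch c N (fiberwise (2 ^ (N - n))%N q) f.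
Proof.
move=> nN x; apply: contra => /eqP e; rewrite !(code_div cod _ nN) e /fiberwise.
have J0 : (0 < 2 ^ (N - n))%N by rewrite expn_gt0.
by rewrite divnMDl// (divn_small (ltn_pmod _ J0)) addn0.
Qed.

Lemma tolerance_small (e : R) : 0 < e -> exists n0, forall n, (n0 <= n)%N -> tolerance R n <= e.
Proof.
move=> e0; exists (Num.truncn e^-1) => n en.
have pos : (0 < 2 ^ n * 5 ^ (2 ^ n).+2)%N by rewrite muln_gt0 !expn_gt0.
rewrite /tolerance -[leRHS]invrK lef_pV2 ?posrE ?invr_gt0 ?ltr0n//.
apply: le_trans (ltW (truncnS_gt _)) _; rewrite ler_nat.
apply: (@leq_trans (2 ^ n)); first exact: leq_ltn_trans en (ltn_expl n (ltnSn 1)).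
by rewrite leq_pmulr// expn_gt0.
Qed.

Lemma tolerance_le k j : (k < j)%N -> tolerance R j <= tolerance R k / 2.
Proof.
elim: j => // j IH; rewrite ltnS leq_eqVlt => /predU1P[->|/IH kj].
  exact: toleranceS.
apply: le_trans (toleranceS R j) _; apply: le_trans kj.
by have := tolerance_gt0 R j; lra.
Qed.

(** Functions on [nat] rather than permutations of a finite ordinal give models of all levels one
    type, so that a sequence of them can be formed. *)
Record pair_model := PairModel {
  level : nat;
  fst_perm : nat -> nat; fst_inv : nat -> nat;
  snd_perm : nat -> nat; snd_inv : nat -> nat }.

Definition pair_model_wf M := perm_below (2 ^ level M) (fst_perm M) (fst_inv M) /\
  perm_below (2 ^ level M) (snd_perm M) (snd_inv M).

(** The quarter leaves room: all later jumps together at most double it, so the limit stays strictly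
    within the tolerance of level [n]. *)
Definition jump_small n s N s' := prb P [set x |
  (s' (c N x) %/ 2 ^ (N - n))%N != s (c n x)] <= tolerance R n / 4.

Lemma refine_model M m i l : pair_model_wf M -> exists M',
  [/\ pair_model_wf M', (level M < level M')%N,
      jump_small (level M) (fst_perm M) (level M') (fst_perm M') /\
      jump_small (level M) (snd_perm M) (level M') (snd_perm M') &
      [/\ (l <= level M')%N, (m <= level M')%N &
        exists y, coherent (level M') (fst_perm M') (snd_perm M') m i y]].
Proof.
case: M => n s s' t t' [/= ss' tt']; rewrite /pair_model_wf /=.
have t4 : (0 : R) < tolerance R n / 4 by have := tolerance_gt0 R n; lra.
(* The second entry makes 2^-K at most a quarter of the tolerance; the first one puts the new level
   above [l]. *)
pose K := maxn l (Num.truncn (tolerance R n / 4)^-1).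
have [N [S [S' [Z [Z' [y [[nN mN KN] [SS' ZZ'] coh hZ hS]]]]]]] := refine_pair m i K ss' tt'.
exists (PairModel N S S' Z Z'); split=> //=; last first.
  split=> //; last by exists y.
  exact: leq_trans (leq_maxl l _) (ltnW KN).
have cE x : c n x = (c N x %/ 2 ^ (N - n))%N by exact: (code_div cod x (ltnW nN)).
have jE r r' : prb P [set x | (r' (c N x) %/ 2 ^ (N - n))%N != r (c n x)] =
    #|[pred a : 'I_(2 ^ N) | r' a %/ 2 ^ (N - n) != r (a %/ 2 ^ (N - n))]%N|%:R
    / (2 ^ N)%:R.
  rewrite -(uniform_prb (fun a => (r' a %/ 2 ^ (N - n))%N != r (a %/ 2 ^ (N - n))%N) (u N)).
  by congr (prb P _); apply/seteqP; split=> x /=; rewrite cE.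
rewrite /jump_small !jE; split; last first.
  rewrite eq_card0 ?mul0r ?ltW// => a; rewrite !inE hZ ?eqxx//.
rewrite ler_pdivrMr ?ltr0n ?expn_gt0//.
have : #|[pred a : 'I_(2 ^ N) | S a %/ 2 ^ (N - n) != s (a %/ 2 ^ (N - n))]%N|%:R
    * (2 ^ K)%:R <= (2 ^ N)%:R :> R.
  by rewrite -natrM ler_nat.
rewrite -ler_pdivlMr ?ltr0n ?expn_gt0// => /le_trans; apply.
rewrite mulrC ler_pM2r ?ltr0n ?expn_gt0// -[leRHS]invrK lef_pV2 ?posrE ?invr_gt0 ?ltr0n ?expn_gt0//.
apply: le_trans (ltW (truncnS_gt _)) _; rewrite ler_nat.
exact: leq_ltn_trans (leq_maxr l _) (ltn_expl K (ltnSn 1)).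
Qed.

(** Stage [k + 1] meets the requirement [req k]. Later stages cannot spoil it, since each jump is
    bounded by the tolerance of the level it starts from, and these tolerances at least halve at
    each stage. *)
Lemma model_sequence M0 (req : nat -> nat * nat * nat) : pair_model_wf M0 ->
  exists M : nat -> pair_model, M 0%N = M0 /\ forall k,
  [/\ pair_model_wf (M k), (level (M k) < level (M k.+1))%N,
      jump_small (level (M k)) (fst_perm (M k)) (level (M k.+1)) (fst_perm (M k.+1)),
      jump_small (level (M k)) (snd_perm (M k)) (level (M k.+1)) (snd_perm (M k.+1)) &
      [/\ ((req k).2 <= level (M k.+1))%N, ((req k).1.1 <= level (M k.+1))%N &
        exists y, coherent (level (M k.+1)) (fst_perm (M k.+1)) (snd_perm (M k.+1))
          (req k).1.1 (req k).1.2 y]].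
Proof.
move=> wf0; have /choice[next hnext] : forall kM : nat * pair_model, exists M',
    pair_model_wf kM.2 ->
  [/\ pair_model_wf M', (level kM.2 < level M')%N,
      jump_small (level kM.2) (fst_perm kM.2) (level M') (fst_perm M') /\
      jump_small (level kM.2) (snd_perm kM.2) (level M') (snd_perm M') &
      [/\ ((req kM.1).2 <= level M')%N, ((req kM.1).1.1 <= level M')%N &
        exists y, coherent (level M') (fst_perm M') (snd_perm M')
          (req kM.1).1.1 (req kM.1).1.2 y]].
  move=> [k M]; have [wf|nwf] := pselect (pair_model_wf M); last by exists M.
  by have [M' hM'] := refine_model (req k).1.1 (req k).1.2 (req k).2 wf; exists M'.
pose M := fix M k := if k is k'.+1 then next (k', M k') else M0.
have wf k : pair_model_wf (M k) by elim: k => // k /(hnext (k, M k))[].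
exists M; split=> // k; have /= [_ lt [js jt] req_k] := hnext (k, M k) (wf k).
by split.
Qed.

Definition generic_pairs : set (maps P * maps P) :=
  \bigcap_k (if unpickle k is Some mil then model_pairs c mil.1.1 mil.1.2 mil.2 else setT).

Lemma generic_pairsP st : generic_pairs st -> forall m i l, model_pairs c m i l st.
Proof. by move=> h m i l; have := h (pickle (m, i, l)) Logic.I; rewrite pickleK. Qed.

Lemma generic_pairs_Gdelta : Gdelta generic_pairs.
Proof.
exists (fun k => if unpickle k is Some mil then
  model_pairs c mil.1.1 mil.1.2 mil.2 else setT) => // k.
case: (unpickle k) => [mil|]; [exact: open_model_pairs|exact: openT].
Qed.

Lemma generic_pairs_dense : dense generic_pairs.
Proof.
move=> W [[sigma tau] Wst] oW.
have [[U V] [/= Us Vt] UVW] : nbhs (sigma, tau) W by exact: open_nbhs_nbhs.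
have [n1 [q1 [q1' [e1 [qq1 e10 h1]]]]] := weak_nbhd_model (open_interior U) Us.
have [n2 [q2 [q2' [e2 [qq2 e20 h2]]]]] := weak_nbhd_model (open_interior V) Vt.
have [a1 ha1] := tolerance_small e10; have [a2 ha2] := tolerance_small e20.
(* A common level for both initial models, high enough for its tolerance to fit both neighbourhoods;
   the bound at stage 0 then places the limit pair in [W]. *)
pose N := maxn (maxn n1 n2) (maxn a1 a2).
have [n1N n2N a1N a2N] : [/\ (n1 <= N)%N, (n2 <= N)%N, (a1 <= N)%N & (a2 <= N)%N].
  by rewrite /N; split; lia.
have lift n q q' : (n <= N)%N -> perm_below (2 ^ n) q q' ->
    perm_below (2 ^ N) (fiberwise (2 ^ (N - n))%N q) (fiberwise (2 ^ (N - n))%N q').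
  by move=> nN qq; have := fiberwise_perm_below (J := (2 ^ (N - n))%N) qq; rewrite -expnD subnKC.
pose M0 := PairModel N (fiberwise (2 ^ (N - n1))%N q1) (fiberwise (2 ^ (N - n1))%N q1')
  (fiberwise (2 ^ (N - n2))%N q2) (fiberwise (2 ^ (N - n2))%N q2').
have wf0 : pair_model_wf M0 by split; exact: lift.
pose req k : nat * nat * nat := odflt (0, 0, 0)%N (unpickle k).
have [M [M0E hM]] := model_sequence req wf0.
have lev k : (level (M k) < level (M k.+1))%N by have [] := hM k.
pose e k := tolerance R (level (M k)) / 4.
have e_half k : e k.+1 <= e k / 2 by have := tolerance_le (lev k); rewrite /e; lra.
have [F hF] := limit_map cod lev (fun k => (let: And5 w _ _ _ _ := hM k in w).1) e_half
  (fun k => let: And5 _ _ j _ _ := hM k in j).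
have [G hG] := limit_map cod lev (fun k => (let: And5 w _ _ _ _ := hM k in w).2) e_half
  (fun k => let: And5 _ _ _ j _ := hM k in j).
(* A class is evaluated through a representative, which may differ from [f] on a null set. *)
have mism (f : imp_map P) n s : prb P (mismatch c n s (\pi_(maps P)%qT f : maps P)) =
    prb P (mismatch c n s f).
  have [Z [mZ Z0 hZ]] := fun_of_mapsE f.
  have PZ : prb P Z = 0 by rewrite /prb Z0.
  have m1 := mismatch_measurable cod n s (imp_measurable_fun f).
  have m2 := mismatch_measurable cod n s
    (imp_measurable_fun (repr (\pi_(maps P)%qT f : maps P))).
  have sub x : ~ Z x -> (\pi_(maps P)%qT f : maps P) x = f x.
    by move=> nZ; apply: contrapT => /hZ.
  apply/eqP; rewrite eq_le -[X in _ <= X]addr0 -[X in _ && (_ <= X)]addr0 -PZ.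
  apply/andP; split; apply: prb_leU => // x.
    move=> mx; have [|/sub fx] := pselect (Z x); [by right|left].
    by move: mx; rewrite /mismatch /= -fx.
  move=> mx; have [|/sub fx] := pselect (Z x); [by right|left].
  by move: mx; rewrite /mismatch /= -fx.
have close (f : imp_map P) k s : prb P (mismatch c (level (M k)) s f) <= 2 * e k ->
    prb P (mismatch c (level (M k)) s (\pi_(maps P)%qT f : maps P)) < tolerance R (level (M k)).
  by rewrite mism => /le_lt_trans; apply; rewrite /e; have := tolerance_gt0 R (level (M k)); lra.
have unlift (f : maps P) n q r : (n <= N)%N ->
    prb P (mismatch c N (fiberwise (2 ^ (N - n))%N q) f) < tolerance R N ->
    tolerance R N <= r -> prb P (mismatch c n q f) < r.
  move=> nN ml lr; apply: lt_le_trans lr; apply: le_lt_trans ml.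
  have mf := imp_measurable_fun (repr f).
  by apply: prb_le; [| |exact: mismatch_lift]; exact: (mismatch_measurable cod).
exists ((\pi_(maps P)%qT F : maps P), (\pi_(maps P)%qT G : maps P)); split.
  by apply: UVW; split=> /=; apply: interior_subset; [apply: h1|apply: h2];
    [apply: (unlift _ _ _ _ n1N _ (ha1 _ a1N))|apply: (unlift _ _ _ _ n2N _ (ha2 _ a2N))];
    [have := close _ _ _ (hF 0%N)|have := close _ _ _ (hG 0%N)]; rewrite M0E.
move=> k _; case uk: (unpickle k) => [[[m i] l]|//] /=.
have [_ _ _ _ [lk mk [y coh]]] := hM k; rewrite /req uk /= in lk mk coh.
exists (level (M k.+1)), (fst_perm (M k.+1)), (snd_perm (M k.+1)), y; split=> //; exact: close.
Qed.

End generic_pairs.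

(** * Binary codings of standard Lebesgue spaces *)

Section real_laws.
Context d (T : measurableType d) (R : realType) (P : probability T R).

Lemma uniform_point_le N (X : T -> nat) i : uniform_below P N X ->
  prb P [set x | X x = i] <= N%:R^-1.
Proof.
move=> [lt _ XP]; have [iN|Ni] := ltnP i N; first by rewrite XP.
rewrite (_ : [set x | X x = i] = set0) ?prb0 ?invr_ge0//.
by apply/seteqP; split=> // x /= Xi; move: (lt x); rewrite Xi ltnNge Ni.
Qed.

Definition dyadic_value (c : nat -> T -> nat) n x : R := (c n x)%:R / (2 ^ n)%:R.

(* [L x] is the real number with binary digits [c n x]. *)
Definition represents (c : nat -> T -> nat) (L : T -> R) :=
  forall n x, dyadic_value c n x <= L x <= dyadic_value c n x + (2 ^ n)%:R^-1.

Let pow0 n : (0 : R) < (2 ^ n)%:R.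
Proof. by rewrite ltr0n expn_gt0. Qed.

Lemma half_pow_small (e : R) : 0 < e -> exists n, (2 ^ n)%:R^-1 < e.
Proof.
move=> e0; exists (Num.truncn e^-1); rewrite -[ltRHS]invrK ltf_pV2 ?posrE ?invr_gt0//.
apply: lt_le_trans (truncnS_gt _) _; rewrite ler_nat.
exact: ltn_expl.
Qed.

Lemma measurable_le_ray (M : T -> R) a : measurable_fun setT M ->
  measurable [set x | M x <= a].
Proof.
move=> mM; have := mM measurableT `]-oo, a]%classic (measurable_itv _).
by rewrite setTI; congr measurable; apply/seteqP; split=> x; rewrite /= in_itv.
Qed.

(** At resolution [n] both rays are compared with the same set of codes, whose measure depends only
    on uniformity. Only the code of the cell containing [a] can be decided wrongly, at a cost of at
    most 2^-n. *)
Lemma law_le_rays c c' (L L' : T -> R) a : dyadic_digits P c -> dyadic_digits P c' ->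
  represents c L -> represents c' L' -> measurable_fun setT L -> measurable_fun setT L' ->
  prb P [set x | L x <= a] <= prb P [set x | L' x <= a].
Proof.
move=> [uc _] [uc' _] cL cL' mL mL'.
apply/ler_addgt0Pr => e e0; have [n ne] := half_pow_small e0.
pose Q (k : nat) := k%:R / (2 ^ n)%:R <= a.
have mQ : measurable [set x | Q (c n x)].
  by have [_ mc _] := uc n; exact: digit_measurable_pred.
have mQ' : measurable [set x | Q (c' n x)].
  by have [_ mc _] := uc' n; exact: digit_measurable_pred.
have mcell : measurable [set x | c' n x = Num.truncn (a * (2 ^ n)%:R)].
  by have [_ mc _] := uc' n; exact: mc.
apply: (@le_trans _ _ (prb P [set x | Q (c n x)])).
  apply: prb_le => //; first exact: measurable_le_ray.
  by move=> x /= La; have /andP[h _] := cL n x; exact: le_trans h La.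
rewrite (uniform_prb Q (uc n)) -(uniform_prb Q (uc' n)).
apply: le_trans (prb_leU P mQ' (measurable_le_ray a mL') mcell _) _.
  move=> x /= Qx; have [|La] := leP (L' x) a; [by left|right].
  have /andP[_ h] := cL' n x; apply/esym; apply: truncn_def.
  apply/andP; split; first by rewrite -ler_pdivrMr.
  rewrite -ltr_pdivlMr// -natr1 mulrDl div1r.
  exact: lt_le_trans La h.
by rewrite lerD2l; apply: le_trans (uniform_point_le _ (uc' n)) (ltW ne).
Qed.

Lemma law_unique c c' (L L' : T -> R) : dyadic_digits P c -> dyadic_digits P c' ->
  represents c L -> represents c' L' -> measurable_fun setT L -> measurable_fun setT L' ->
  forall B, measurable B -> P (L @^-1` B) = P (L' @^-1` B).
Proof.
move=> uc uc' cL cL' mL mL'.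
pose X := mfun_Sub (mem_set mL : L \in mfun).
pose X' := mfun_Sub (mem_set mL' : L' \in mfun).
have rayE (M : T -> R) a : M @^-1` `]a, +oo[%classic = ~` [set x | M x <= a].
  by apply/seteqP; split=> x; rewrite /preimage /= in_itv /= andbT ltNge => /negP.
move=> B mB; change (distribution P X B = distribution P X' B).
apply: (@measure_unique _ R _ (@RGenOInfty.G R) (fun n => `](- n%:R)%R, +oo[%classic) _ _ _ _
  (distribution P X) (distribution P X') _ _ B mB).
- exact: RGenOInfty.measurableE.
- move=> _ _ [a ->] [b ->]; exists (Num.max a b); apply/seteqP; split=> x /=.
    by rewrite !in_itv /= !andbT gt_max => -[-> ->].
  by rewrite !in_itv /= !andbT gt_max => /andP[-> ->].
- by move=> n; exists (- n%:R).
- apply/seteqP; split=> // x _; exists (Num.truncn `|x|).+1 => //=.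
  rewrite in_itv /= andbT; have := truncnS_gt `|x|.
  by rewrite ltr_norml => /andP[].
- move=> _ [a ->]; change (P (L @^-1` `]a, +oo[%classic) = P (L' @^-1` `]a, +oo[%classic)).
  have ray (M : T -> R) := @measurable_le_ray M a.
  rewrite (rayE L) (rayE L') !prbE ?prbC; try by [exact: ray|apply: measurableC; exact: ray].
  congr (1 - _)%:E; apply/eqP; rewrite eq_le; apply/andP.
  split; [exact: law_le_rays uc uc' cL cL' mL mL'|exact: law_le_rays uc' uc cL' cL mL' mL].
- by move=> n; rewrite (le_lt_trans (probability_le1 _ _))// ?ltry//; exact: measurable_itv.
Qed.

(** The inequalities in [represents] are not strict, so a dyadic [q] is compatible with two adjacent
    codes; each has measure at most 2^-n. *)
Lemma represents_point0 c (L : T -> R) q : dyadic_digits P c -> represents c L ->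
  measurable_fun setT L -> P (L @^-1` [set q]) = 0%E.
Proof.
move=> [uc half] cL mL.
have mq : measurable (L @^-1` [set q]).
  by rewrite -[_ @^-1` _]setTI; apply: mL => //; exact: measurable_set1.
apply: prb0P => // e e0; have e2 : 0 < e / 2 by lra.
have [n ne] := half_pow_small e2; have [_ mc _] := uc n.
pose k := Num.truncn (q * (2 ^ n)%:R).
apply: (@le_trans _ _ (prb P ([set x | c n x = k] `|` [set x | c n x = k.-1]))).
  apply: prb_le => //; first by apply: measurableU; exact: mc.
  move=> x /= Lq; have := cL n x; rewrite Lq /dyadic_value => /andP[].
  rewrite ler_pdivrMr// -[X in _ <= _ + X]mul1r -mulrDl natr1 ler_pdivlMr// => h1 h2.
  move: h2; rewrite le_eqVlt => /orP[/eqP h2|h2]; last first.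
    by left; apply/esym; apply: truncn_def; rewrite h1 h2.
  by right; rewrite /k h2 natrK.
apply: le_trans (prbU P (mc _) (mc _)) _.
have := uniform_point_le k (uc n); have := uniform_point_le k.-1 (uc n); lra.
Qed.

End real_laws.

(** * Binary digits of an isomorphism with the unit interval *)

Section real_coding.
Context d (T : measurableType d) (R : realType) (P : probability T R).

(** Completeness inside [T0] only, since the isomorphism gives no information on subsets of the
    complement. *)
Definition complete_on (T0 : set T) := forall Z Z' : set T,
  Z `<=` Z' -> Z' `<=` T0 -> measurable Z' -> P Z' = 0%E -> measurable Z.

(* An isomorphism mod null sets with [0, 1), phrased inside [T] so that it covers
   the Borel and the Lebesgue sigma-algebra alike. *)
Record real_coding (phi : T -> R) (T0 : set T) : Prop := RealCoding {
  rc_measurable : measurable_fun setT phi;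
  rc_range : forall x, 0 <= phi x < 1;
  rc_cell : forall n i, (i < 2 ^ n)%N ->
    prb P [set x | i%:R / (2 ^ n)%:R <= phi x < i.+1%:R / (2 ^ n)%:R] = (2 ^ n)%:R^-1;
  rc_conull : measurable T0 /\ P (~` T0) = 0%E;
  rc_inj : forall x y, T0 x -> T0 y -> phi x = phi y -> x = y;
  rc_onto : exists V, [/\ measurable V, V `<=` phi @` T0 & P (~` (phi @^-1` V)) = 0%E];
  rc_sets : forall A, measurable A -> A `<=` T0 -> exists B N N',
    [/\ measurable B, measurable N /\ P (phi @^-1` N) = 0%E,
        phi @` A = B `|` N', N' `<=` N & N' = set0 \/ complete_on T0] }.

Context (phi : T -> R) (T0 : set T) (rc : real_coding phi T0).

Definition binary_code n x := Num.truncn (phi x * (2 ^ n)%:R).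

Let pow0 n : (0 : R) < (2 ^ n)%:R.
Proof. by rewrite ltr0n expn_gt0. Qed.

Let pre B : measurable B -> measurable (phi @^-1` B).
Proof. by move=> mB; rewrite -[_ @^-1` _]setTI; exact: (rc_measurable rc). Qed.

Let scaled_ge0 n x : 0 <= phi x * (2 ^ n)%:R.
Proof. by have /andP[p _] := rc_range rc x; rewrite mulr_ge0. Qed.

Lemma code_cell n i : [set x | binary_code n x = i] =
  [set x | i%:R / (2 ^ n)%:R <= phi x < i.+1%:R / (2 ^ n)%:R].
Proof.
apply/seteqP; split=> x /=; rewrite ler_pdivrMr// ltr_pdivlMr//.
  by move=> <-; exact: truncn_itv.
by move=> h; exact: truncn_def.
Qed.

Lemma code_digits : dyadic_digits P binary_code.
Proof.
split=> [n|n x].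
  split=> [x|i|i iN].
  - have /andP[_ p1] := rc_range rc x.
    by rewrite truncn_lt_nat// -[ltRHS]mul1r ltr_pM2r.
  - rewrite code_cell.
    have := pre (measurable_itv `[i%:R / (2 ^ n)%:R, i.+1%:R / (2 ^ n)%:R[).
    by congr measurable; apply/seteqP; split=> x; rewrite /preimage /= in_itv.
  - by rewrite code_cell; exact: (rc_cell rc).
apply: truncn_def; have /andP[h1 h2] := truncn_itv (scaled_ge0 n.+1 x).
rewrite -/(binary_code n.+1 x) in h1 h2; set k := binary_code n.+1 x in h1 h2 *.
move: h1 h2; rewrite expnS natrM mulrCA.
have := odd_double_half k; move: (k./2) => j; case: (odd k) => <-;
  rewrite ?add1n ?add0n -muln2 -!natr1 ?natrM; move: (phi x * _) => y; lra.
Qed.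

Lemma code_represents : represents binary_code phi.
Proof.
move=> n x; rewrite /dyadic_value -[X in _ + X]mul1r -mulrDl natr1.
have /andP[h1 h2] := truncn_itv (scaled_ge0 n x).
by rewrite ler_pdivrMr// ler_pdivlMr// h1 ltW.
Qed.

Lemma code_inj x y : (forall n, binary_code n x = binary_code n y) -> phi x = phi y.
Proof.
move=> h; apply/eqP; rewrite -subr_eq0 -normr_eq0 eq_le normr_ge0 andbT.
apply/ler_addgt0Pr => e e0; rewrite add0r; have [n ne] := half_pow_small e0.
have := code_represents n x; have := code_represents n y.
by rewrite /dyadic_value h => /andP[h1 h2] /andP[h3 h4]; rewrite ler_norml; apply/andP; split; lra.
Qed.

Definition code_approximable (A : set T) := measurable A /\ forall e : R, 0 < e ->
  exists n (S : pred nat), prb P (A `+` [set x | S (binary_code n x)]) < e.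

Let mcode n (S : pred nat) : measurable [set x | S (binary_code n x)].
Proof.
by have [u _] := code_digits; have [_ mc _] := u n; exact: digit_measurable_pred.
Qed.

Let mY A n (S : pred nat) : measurable A -> measurable (A `+` [set x | S (binary_code n x)]).
Proof. by move=> mA; apply: measurableU; exact: measurableD. Qed.

(** The tail of the union beyond [m] costs less than [e / 2], the individual approximations a
    geometric series with sum [e / 4], and finitely many codes can be read off one common level. *)
Lemma code_approximable_bigcup (A : (set T)^nat) :
  (forall k, code_approximable (A k)) -> code_approximable (\bigcup_k A k).
Proof.
move=> hA; have mA k : measurable (A k) := (hA k).1.
have mU : measurable (\bigcup_k A k) by exact: bigcupT_measurable.
split=> // e e0.
pose U m := \big[setU/set0]_(k < m) A k.
have mUm m : measurable (U m) by apply: bigsetU_measurable.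
have [m hm] : exists m, prb P (\bigcup_k A k `\` U m) < e / 2.
  have mD m : measurable (\bigcup_k A k `\` U m) by exact: measurableD.
  have F0 : \bigcap_m (\bigcup_k A k `\` U m) = set0.
    apply/seteqP; split=> // x xm; have [[k _ Ax] _] := xm 0%N Logic.I.
    have [_] := xm k.+1 Logic.I; apply; rewrite /U -bigcup_seq.
    by exists ord_max; rewrite //= mem_index_enum.
  have := @nonincreasing_cvg_mu _ _ _ P (fun m => \bigcup_k A k `\` U m).
  rewrite F0 measure0 => /(_ _ mD measurable0 _) cv.
  have e2 : 0 < e / 2 by lra.
  have [||m _ hm] := cv _ _ _ (@nbhs_open_ereal_lt R 0 (fun=> e / 2) e2).
  - by rewrite (le_lt_trans (probability_le1 _ _))// ltry.
  - move=> i j ij; apply/subsetPset => x [Ax nU]; split=> // Ux; apply: nU.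
    move: Ux; rewrite /U -!bigcup_seq => -[k _ Ak].
    by exists (widen_ord ij k); rewrite //= mem_index_enum.
  - by exists m; have := hm m (leqnn m); rewrite /= prbE// lte_fin.
have e2 k : 0 < e / 4 / (2 ^ k.+1)%:R :> R by rewrite divr_gt0//; lra.
have /choice[nS hnS] : forall k, exists nS : nat * pred nat,
    prb P (A k `+` [set x | nS.2 (binary_code nS.1 x)]) < e / 4 / (2 ^ k.+1)%:R.
  by move=> k; have [n [S hS]] := (hA k).2 _ (e2 k); exists (n, S).
pose N := (\max_(k < m) (nS k).1)%N.
pose S a := [exists k : 'I_m, (nS k).2 (a %/ 2 ^ (N - (nS k).1))%N].
exists N, S; pose E := \bigcup_k (A k `+` [set x | (nS k).2 (binary_code (nS k).1 x)]).
have mE : measurable E by apply: bigcupT_measurable => k; exact: mY.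
have PE : prb P E <= e / 4.
  apply: prb_bigcup_geo; [lra|by move=> k; exact: mY|by move=> k; exact: ltW].
apply: le_lt_trans (_ : _ <= prb P (\bigcup_k A k `\` U m) + prb P E) _; last lra.
apply: prb_leU => //; [exact: mY|exact: measurableD|].
have SE (k : 'I_m) x : (nS k).2 (binary_code N x %/ 2 ^ (N - (nS k).1))%N =
    (nS k).2 (binary_code (nS k).1 x).
  rewrite (dyadic_digits_div x code_digits (n := (nS k).1) (N := N))//.
  exact: (leq_bigmax (F := fun k : 'I_m => (nS k).1) k).
move=> x [[Ax nS_]|[/existsP[k]]].
  have [Ux|nU] := pselect (U m x); last by left.
  right; move: Ux; rewrite /U -bigcup_seq => -[k _ Ak].
  exists (nat_of_ord k) => //; left; split=> //= Sk; apply: nS_ => /=.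
  by apply/existsP; exists k; rewrite SE.
rewrite SE => Sk nA; right; exists (nat_of_ord k) => //; right; split=> // Ak.
by apply: nA; exists (nat_of_ord k).
Qed.

(** The good sets form a sigma-algebra containing the open rays: a ray differs from its code
    approximation only inside the cell of its end point. *)
Lemma code_approximable_preimage B : measurable B -> code_approximable (phi @^-1` B).
Proof.
suff sub : (@measurable _ (measurableTypeR R)) `<=` [set B | code_approximable (phi @^-1` B)].
  by move=> mB; exact: sub.
have -> : @measurable _ (measurableTypeR R) = <<s @RGenOInfty.G R >> := RGenOInfty.measurableE R.
apply: smallest_sub; first split.
- rewrite /= preimage_set0; split=> // e e0; exists 0%N, xpred0.
  rewrite (_ : _ `+` _ = set0) ?prb0//.
  by apply/seteqP; split=> x //= [[]|[]].
- move=> D /= [mD hD]; rewrite setTD preimage_setC; split; first exact: measurableC.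
  move=> e /hD[n [S hS]]; exists n, (predC S); move: hS; congr (prb P _ < _).
  rewrite (_ : [set x | predC S _] = ~` [set x | S (binary_code n x)]); last first.
    by apply/seteqP; split=> x /= /negP.
  move: [set x | _] => U; apply/seteqP; split=> x; rewrite /preimage /=;
    have [?|?] := pselect (U x); have [?|?] := pselect (D (phi x)); tauto.
- by move=> D hD /=; rewrite preimage_bigcup; exact: code_approximable_bigcup.
move=> _ [a ->] /=; split; first exact: pre (measurable_itv _).
move=> e e0; have [n ne] := half_pow_small e0.
exists n, (fun k => a < k%:R / (2 ^ n)%:R).
have [u _] := code_digits; apply: le_lt_trans ne.
apply: le_trans (uniform_point_le (Num.truncn (a * (2 ^ n)%:R)) (u n)).
have mray := pre (measurable_itv `]a, +oo[).
apply: prb_le; [|by have [_ mc _] := u n; exact: mc|].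
  exact: (@mY _ n (fun k => a < k%:R / (2 ^ n)%:R) mray).
move=> x; have /andP[h1 h2] := code_represents n x.
have := truncn_itv (scaled_ge0 n x); rewrite -/(binary_code n x) => /andP[h3 h4].
rewrite /setY /preimage /= in_itv /= andbT => -[[ax /negP]|[ax /negP]].
  rewrite -leNgt ler_pdivrMr// => ca; apply/esym/truncn_def; rewrite ca /=.
  by apply: lt_trans h4; rewrite ltr_pM2r.
by rewrite -leNgt => pa; have := lt_le_trans ax (le_trans h1 pa); rewrite ltxx.
Qed.

Lemma real_coding_mod_null A : measurable A -> exists B N N',
  [/\ measurable B, measurable N /\ P (phi @^-1` N) = 0%E,
      phi @` (A `&` T0) = B `|` N', N' `<=` N /\ (N' = set0 \/ complete_on T0) &
      P (A `+` phi @^-1` B) = 0%E].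
Proof.
move=> mA; have [mT0 T00] := rc_conull rc.
have [B [N [N' [mB [mN N0] AB N'N comp]]]] := rc_sets rc (measurableI _ _ mA mT0)
  (@subIsetr _ A T0).
exists B, N, N'; split=> //.
have mN0 : measurable (phi @^-1` N) by exact: pre.
apply: (prb0_subset (B := ~` T0 `|` phi @^-1` N)).
- by apply: measurableU; apply: measurableD => //; exact: pre.
- by apply: measurableU => //; exact: measurableC.
- move=> x [[Ax nB]|[Bx nA]]; have [Tx|nT] := pselect (T0 x); try by left.
    right; have : (phi @` (A `&` T0)) (phi x) by exists x.
    by rewrite AB => -[|/N'N].
  have : (phi @` (A `&` T0)) (phi x) by rewrite AB; left.
  by move=> [y [Ay Ty] /(rc_inj rc Ty Tx) yx]; case: nA; rewrite -yx.
- by apply: prb0_setU => //; exact: measurableC.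
Qed.

Lemma code_approx A (e : R) : measurable A -> 0 < e ->
  exists n (S : pred nat), prb P (A `+` [set x | S (binary_code n x)]) < e.
Proof.
move=> mA e0; have [B [_ [_ [mB _ _ _ AB]]]] := real_coding_mod_null mA.
have [_ /(_ e e0)[n [S hS]]] := code_approximable_preimage mB.
exists n, S; apply: le_lt_trans hS.
have mAB : measurable (A `+` phi @^-1` B).
  by apply: measurableU; apply: measurableD => //; exact: pre.
have PAB : prb P (A `+` phi @^-1` B) = 0 by rewrite /prb AB.
rewrite -[leRHS]add0r -PAB; apply: prb_leU => //; [exact: mY|apply: mY; exact: pre|].
move=> x; have [Ax|nA] := pselect (A x); have [Bx|nB] := pselect ((phi @^-1` B) x);
  rewrite /setY /=; tauto.
Qed.

(** Let [L x] be the real number with digits [c' n x]. It has the same law as [phi], hence almost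
    surely lies in a Borel part of the range of [phi]; there [f] is [L] followed by the inverse of
    [phi], and elsewhere the identity. *)
Lemma code_realize c' : dyadic_digits P c' -> exists f : T -> T,
  [/\ measurable_fun setT f, forall A, measurable A -> P (f @^-1` A) = P A &
      \forall x \ae P, forall n, binary_code n (f x) = c' n x].
Proof.
move=> dc'; pose E x := [set dyadic_value R c' n x | n in setT].
pose L x := sup (E x).
(* Nested binary intervals: every left end point lies below every right end point, so the supremum
   [L x] belongs to all of them. *)
have below k n x : dyadic_value R c' k x <= dyadic_value R c' n x + (2 ^ n)%:R^-1.
  rewrite /dyadic_value -[X in _ + X]mul1r -mulrDl natr1 ler_pdivrMr// mulrAC ler_pdivlMr//.
  rewrite -!natrM ler_nat; have [kn|/ltnW nk] := leqP k n.
    rewrite (dyadic_digits_div x dc' kn).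
    have -> : (2 ^ n = 2 ^ (n - k) * 2 ^ k)%N by rewrite -expnD subnK.
    by rewrite mulnA leq_mul2r (leq_trans (leq_divM _ _))// ?orbT.
  rewrite (dyadic_digits_div x dc' nk).
  have -> : (2 ^ k = 2 ^ (k - n) * 2 ^ n)%N by rewrite -expnD subnK.
  by rewrite mulnA leq_mul2r ltnW ?orbT// ltn_ceil// expn_gt0.
have E0 x : E x !=set0 by exists (dyadic_value R c' 0 x); exists 0%N.
have Eub x : has_ubound (E x).
  by exists (dyadic_value R c' 0 x + (2 ^ 0)%:R^-1) => _ [k _ <-]; exact: below.
have cL : represents c' L.
  move=> n x; apply/andP; split; first by apply: ub_le_sup => //; exists n.
  by apply: ge_sup => // _ [k _ <-]; exact: below.
have mL : measurable_fun setT L.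
  apply: (measurability (@RGenOInfty.G R)); first exact: RGenOInfty.measurableE.
  move=> _ [_ [a ->] <-]; rewrite setTI.
  rewrite [X in measurable X](_ : _ =
      \bigcup_n [set x | (fun k => a < k%:R / (2 ^ n)%:R) (c' n x)]).
    apply: bigcupT_measurable => n; have [u _] := dc'; have [_ mc _] := u n.
    exact: (digit_measurable_pred (fun k => a < k%:R / (2 ^ n)%:R) mc).
  apply/seteqP; split=> x; rewrite /preimage /= in_itv /= andbT.
    by move=> /(sup_gt (E0 x))[_ [n _ <-] an]; exists n.
  by move=> [n _ /= an]; have /andP[h _] := cL n x; exact: lt_le_trans an h.
have law := law_unique dc' code_digits cL code_represents mL (rc_measurable rc).
have preL B : measurable B -> measurable (L @^-1` B).
  by move=> mB; rewrite -[_ @^-1` _]setTI; exact: mL.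
have [V [mV VT V0]] := rc_onto rc; have [mT0 T00] := rc_conull rc.
pose C := T0 `&` L @^-1` V.
have mC : measurable C by apply: measurableI => //; exact: preL.
have C0 : P (~` C) = 0%E.
  apply: (prb0_subset (B := ~` T0 `|` ~` (L @^-1` V))).
  - exact: measurableC.
  - by apply: measurableU; apply: measurableC => //; exact: preL.
  - by rewrite /C setCI.
  - have mV' : measurable (~` (L @^-1` V)) by apply: measurableC; exact: preL.
    apply: prb0_setU => //; first exact: measurableC.
    by rewrite preimage_setC law -?preimage_setC//; exact: measurableC.
have /choice[f hf] : forall x, exists y, (C x -> T0 y /\ phi y = L x) /\ (~ C x -> y = x).
  move=> x; have [Cx|nC] := pselect (C x); last by exists x.
  by have [y Ty yL] := VT _ Cx.2; exists y.
have fpre A : f @^-1` A = (A `\` C) `|` (C `&` L @^-1` (phi @` (A `&` T0))).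
  apply/seteqP; split=> x; rewrite /preimage /=.
    move=> Af; have [Cx|nC] := pselect (C x).
      by right; split=> //; have [Tf pf] := (hf x).1 Cx; exists (f x).
    by left; split=> //; rewrite -((hf x).2 nC).
  move=> [[Ax nC]|[Cx [y [Ay Ty] yL]]]; first by rewrite ((hf x).2 nC).
  have [Tf pf] := (hf x).1 Cx.
  by rewrite (rc_inj rc Tf Ty) // pf yL.
have fA A : measurable A -> measurable (f @^-1` A) /\ P (f @^-1` A) = P A.
  move=> mA; have [B [N [N' [mB [mN N0] AB [N'N comp] AB0]]]] := real_coding_mod_null mA.
  have mLN := preL _ mN; have LN0 : P (L @^-1` N) = 0%E by rewrite law.
  have mN' : measurable (C `&` L @^-1` N').
    case: comp => [->|comp]; first by rewrite preimage_set0 setI0.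
    apply: (comp _ (C `&` L @^-1` N)).
    - by apply: setIS; exact: preimage_subset.
    - by move=> x [[]].
    - exact: measurableI.
    - by apply: (prb0_subset _ mLN _ LN0); [exact: measurableI|exact: subIsetr].
  have mf : measurable (f @^-1` A).
    rewrite fpre AB preimage_setU setIUr; apply: measurableU; first exact: measurableD.
    by apply: measurableU => //; apply: measurableI => //; exact: preL.
  split=> //; transitivity (P (L @^-1` B)); last first.
    rewrite law//; apply/esym; apply: prb_squeeze => //; exact: pre.
  apply: prb_squeeze => //; first exact: preL.
  apply: (prb0_subset (B := ~` C `|` L @^-1` N)).
  - by apply: measurableU; apply: measurableD => //; exact: preL.
  - by apply: measurableU => //; exact: measurableC.
  - rewrite fpre AB => x; have [Cx|nC] := pselect (C x); last by left.
    move=> [[[[_ //]|[_ [|/N'N]]]//]|[Bx nf]]; first by right.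
    by case: nf; right; split=> //; left.
  - by apply: prb0_setU => //; exact: measurableC.
exists f; split.
- by move=> _ A mA; rewrite setTI; exact: (fA A mA).1.
- by move=> A mA; exact: (fA A mA).2.
(* When [L x] is a dyadic rational, [binary_code] may select the other binary expansion; such [x]
   form a null set. *)
pose Z := ~` C `|` \bigcup_n \bigcup_i (L @^-1` [set i%:R / (2 ^ n)%:R]).
have mpt n i : measurable (L @^-1` [set i%:R / (2 ^ n)%:R]) by apply: preL; exact: measurable_set1.
have mZ2 : measurable (\bigcup_n \bigcup_i (L @^-1` [set i%:R / (2 ^ n)%:R])).
  by apply: bigcupT_measurable => n; apply: bigcupT_measurable => i; exact: mpt.
exists Z; split.
- by apply: measurableU => //; exact: measurableC.
- apply: prb0_setU => //; first exact: measurableC.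
  apply: measure_negligible => //; apply: negligible_bigcup => n; apply: negligible_bigcup => i.
  by apply/negligibleP => //; exact: represents_point0 dc' cL mL.
move=> x /= nx; apply: contrapT => nZ; apply: nx => n.
have Cx : C x by apply: contrapT => nC; apply: nZ; left.
have [_ pf] := (hf x).1 Cx; rewrite /binary_code pf; apply: truncn_def.
have /andP[h1 h2] := cL n x; apply/andP; split; first by rewrite -ler_pdivrMr.
rewrite -ltr_pdivlMr// lt_neqAle; apply/andP; split; last first.
  by move: h2; rewrite /dyadic_value -[X in _ + X]mul1r -mulrDl natr1.
by apply/eqP => Lx; apply: nZ; right; exists n => //; exists (c' n x).+1.
Qed.

Lemma real_coding_dyadic : dyadic_coding P binary_code.
Proof.
split; [exact: code_digits|exact: code_approx|exact: code_realize|].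
have [mT0 T00] := rc_conull rc; exists T0; split=> // x y Tx Ty cxy.
by apply: (rc_inj rc Tx Ty); exact: code_inj.
Qed.

End real_coding.

(** * Borel and Lebesgue standardness *)

Section standard_spaces.
Context d (T : measurableType d) (R : realType) (P : probability T R).

Local Notation lambda := (@lebesgue_measure R).

Section transport.
Context dU (U : measurableType dU) (nu : {measure set U -> \bar R}) (j : U -> R).
Hypotheses (jinj : injective j) (jsurj : forall r, exists u, j u = r).
Hypothesis mj : measurable_fun setT j.
Hypothesis nuj : forall B, measurable B -> nu (j @^-1` B) = lambda B.
Hypothesis jsets : forall M : set U, measurable M -> exists B N N',
  [/\ measurable B, measurable N /\ lambda N = 0%E, M = j @^-1` B `|` N',
      N' `<=` j @^-1` N & N' = set0 \/ measure_is_complete nu].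

(** [U] stands for the real line with either sigma-algebra and [j] for the identity, so one argument
    treats both conventions. The coding is [f] followed by [j], with the harmless value 0 on the
    null set outside [T0]. *)
Lemma iso_real_coding : iso_mod_null P nu (j @^-1` [set x | 0 <= x < 1]) ->
  exists phi T0, real_coding P phi T0.
Proof.
move=> [T0 [U0 [f [[mT0 T00] [mU0 U0D U00] [fU f_inj f_onto] fB fA]]]].
pose D : set R := [set x | 0 <= x < 1].
have mD : measurable D.
  rewrite (_ : D = `[0, 1[%classic); first exact: measurable_itv.
  by apply/seteqP; split=> x; rewrite /D /= in_itv.
have prej B : measurable B -> measurable (j @^-1` B).
  by move=> mB; rewrite -[_ @^-1` _]setTI; exact: mj.
pose phi x : R := if `[< T0 x >] then j (f x) else 0.
have phiE x : T0 x -> phi x = j (f x) by move=> Tx; rewrite /phi asboolT.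
have phiN x : ~ T0 x -> phi x = 0 by move=> Tx; rewrite /phi asboolF.
have mTf B : measurable B -> measurable (T0 `&` f @^-1` (j @^-1` B `&` U0)).
  by move=> mB; apply: (fB _ _ _).1 => //; apply: measurableI => //; exact: prej.
have mC : measurable (~` T0) by exact: measurableC.
have phipre B : phi @^-1` B `&` T0 = T0 `&` f @^-1` (j @^-1` B `&` U0).
  apply/seteqP; split=> x; rewrite /preimage /=.
    by move=> [Bx Tx]; rewrite -phiE//; split=> //; split=> //; exact: fU.
  by move=> [Tx [Bx _]]; rewrite phiE.
have mphi : measurable_fun setT phi.
  move=> _ B mB; rewrite setTI -[phi @^-1` B](setIT) -(setUv T0) setIUr.
  apply: measurableU; first by rewrite phipre; exact: mTf.
  have [B0|nB0] := pselect (B 0).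
    rewrite (_ : _ `&` _ = ~` T0)//; apply/seteqP; split=> [x []//|x nx].
    by split=> //; rewrite /preimage /= phiN.
  rewrite (_ : _ `&` _ = set0)//; apply/seteqP; split=> // x [Bx nx].
  by move: Bx; rewrite /preimage /= phiN.
have pre B : measurable B -> measurable (phi @^-1` B).
  by move=> mB; rewrite -[_ @^-1` _]setTI; exact: mphi.
have range x : 0 <= phi x < 1.
  have [Tx|nx] := pselect (T0 x); last by rewrite phiN// lexx ltr01.
  by rewrite phiE//; apply: U0D; exact: fU.
have law B : measurable B -> B `<=` D -> P (phi @^-1` B) = lambda B.
  move=> mB BD; transitivity (P (phi @^-1` B `&` T0)).
    apply: prb_squeeze; first exact: pre.
      by apply: measurableI => //; exact: pre.
    apply: (prb0_subset (B := ~` T0)) => //.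
      by apply: measurableU; apply: measurableD;
        try (by apply: measurableI => //; exact: pre); exact: pre.
    move=> x [[Bx nBT]|[[Bx _] nB]] Tx; last exact: nB.
    exact: nBT.
  rewrite phipre (fB _ _ _).2//; last by apply: measurableI => //; exact: prej.
  have mjB := prej _ mB; rewrite -nuj// (measureDI nu mjB mU0).
  rewrite [X in _ = (X + _)%E](_ : _ = 0%E) ?add0e//.
  apply: (subset_measure0 (B := j @^-1` D `\` U0)) => //.
  - exact: measurableD.
  - by apply: measurableD => //; exact: prej.
  - by apply: setSD; exact: preimage_subset.
have law0 N : measurable N -> lambda N = 0%E -> P (phi @^-1` N) = 0%E.
  move=> mN N0; rewrite (_ : phi @^-1` N = phi @^-1` (N `&` D)); last first.
    by apply/seteqP; split=> x; rewrite /preimage /=; [split => //; exact: range|move=> []].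
  rewrite law; [|exact: measurableI|exact: subIsetr].
  by apply: (subset_measure0 _ mN _ N0); [exact: measurableI|exact: subIsetl].
exists phi, T0; split=> //.
- move=> n i iN; set I := (I in prb P I).
  have p0 : (0 : R) < (2 ^ n)%:R by rewrite ltr0n expn_gt0.
  have IE : I = phi @^-1` `[i%:R / (2 ^ n)%:R, i.+1%:R / (2 ^ n)%:R[%classic.
    by apply/seteqP; split=> x; rewrite /I /preimage /= in_itv.
  rewrite /prb IE law; [|exact: measurable_itv|].
    rewrite lebesgue_measure_itv /= lte_fin ltr_pM2r ?invr_gt0// ltr_nat ltnSn.
    by rewrite -EFinD /= -mulrBl -natrB// subSnn mul1r.
  move=> x; rewrite /= in_itv /= /D /= => /andP[h1 h2]; apply/andP; split.
    by apply: le_trans h1; rewrite divr_ge0.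
  apply: lt_le_trans h2 _; rewrite ler_pdivrMr// mul1r ler_nat.
  exact: iN.
- move=> x y Tx Ty; rewrite !phiE// => /jinj; apply: f_inj; exact: mem_set.
(* The Borel part [B] of [U0] lies in the range; what it misses of [0, 1) is covered by the two null
   sets [D] minus [U0] and [N]. *)
- have [B [N [N' [mB [mN N0] U0E N'N _]]]] := jsets mU0.
  exists B; split=> //.
    move=> r Br; have [u ur] := jsurj r; have : U0 u.
      by rewrite U0E; left; rewrite /preimage /= ur.
    by move=> /f_onto[x Tx xu]; exists x => //; rewrite phiE// xu.
  have -> : ~` (phi @^-1` B) = phi @^-1` (D `\` B).
    by apply/seteqP; split=> x; rewrite /preimage /=; [split => //; exact: range|move=> []].
  have mDB : measurable (D `\` B) by exact: measurableD.
  rewrite law// -nuj//.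
  apply: (subset_measure0 (B := (j @^-1` D `\` U0) `|` j @^-1` N)).
  + exact: prej.
  + apply: measurableU; last exact: prej.
    by apply: measurableD => //; exact: prej.
  + move=> u [Du nB]; have [Uu|nU] := pselect (U0 u); last by left.
    by right; move: Uu; rewrite U0E => -[|/N'N].
  + apply/eqP; rewrite eq_le measure_ge0 andbT.
    have m1 : measurable (j @^-1` D `\` U0) by apply: measurableD => //; exact: prej.
    apply: le_trans (measureU2 nu m1 (prej _ mN)) _.
    have n2 : nu (j @^-1` N) = 0%E := etrans (nuj mN) N0.
    by rewrite [X in (X + _ <= _)%E]U00 [X in (_ + X <= _)%E]n2 adde0.
- move=> A mA AT; have mfA := fA A mA AT.
  have [B [N [N' [mB [mN N0] ME N'N comp]]]] := jsets mfA.
  exists B, N, (j @` N'); split=> //.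
  + by split=> //; exact: law0.
  + have -> : phi @` A = j @` (f @` A).
      apply/seteqP; split=> [_ [x Ax <-]|_ [_ [x Ax <-] <-]].
        by exists (f x); [exists x|rewrite phiE//; exact: AT].
      by exists x => //; rewrite phiE//; exact: AT.
    rewrite ME image_setU; congr (_ `|` _); apply/seteqP; split=> [_ [u Bu <-]//|r Br].
    by have [u ur] := jsurj r; exists u => //; rewrite /preimage /= ur.
  + by move=> _ [u /N'N Nu <-].
  + case: comp => [->|comp]; first by left; rewrite image_set0.
    (* Completeness is pulled back through [f]: the image of [Z] lies in a null set of [nu], hence
       is measurable, and [Z] is recovered from it by injectivity on [T0]. *)
    right=> Z Z' ZZ' Z'T mZ' Z'0.
    have mfZ' := fA Z' mZ' Z'T.
    have fU' : f @` Z' `<=` U0 by move=> _ [x Zx <-]; apply: fU; exact: Z'T.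
    have back S : S `<=` T0 -> T0 `&` f @^-1` (f @` S) = S.
      move=> ST; apply/seteqP; split=> [x [Tx [y Sy yx]]|x Sx]; last by split; [exact: ST|exists x].
      by rewrite -(f_inj y x) ?inE//; exact: ST.
    have fZ'0 : nu (f @` Z') = 0%E by rewrite -(fB _ mfZ' fU').2 back.
    have mfZ : measurable (f @` Z).
      by apply: comp; exists (f @` Z'); split=> //; exact: image_subset.
    rewrite -(back Z); last exact: subset_trans ZZ' Z'T.
    apply: (fB _ mfZ _).1; apply: subset_trans fU'; exact: image_subset.
Qed.

End transport.

Lemma standard_lebesgue_coding : standard_lebesgue P ->
  exists c, dyadic_coding P c.
Proof.
suff : standard_lebesgue P -> exists phi T0, real_coding P phi T0.
  by move=> h /h[phi [T0 rc]]; exists (binary_code phi); exact: real_coding_dyadic rc.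
move=> [iso|iso].
  apply: (@iso_real_coding _ _ lambda id) iso => //.
  - by move=> r; exists r.
  - by move=> M mM; exists M, set0, set0; split=> //; [rewrite setU0|left].
apply: (@iso_real_coding _ _ (@completed_lebesgue_measure R) id) iso => //.
- by move=> r; exists r.
- move=> _ B mB; rewrite setTI; exact: sub_caratheodory.
- move=> M mM.
  (* A Lebesgue measurable set is a Borel set together with part of a Borel null set. *)
  have : completed_algebra_gen lambda M.
    by rewrite -g_sigma_completed_algebra_genE completed_caratheodory_measurable.
  move=> [B mB [N' [N [mN N0 N'N]] <-]].
  exists B, N, N'; split=> //.
  by right; exact: completed_lebesgue_measure_is_complete.
Qed.

End standard_spaces.

Theorem proposition5p3 (d : measure_display) (T : measurableType d)
    (R : realType) (P : probability T R) (r : \bar R) :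
  standard_lebesgue P -> (1 <= r)%E ->
  exists E : set (maps P * maps P),
    [/\ Gdelta E, dense E &
      forall sigma tau : maps P, E (sigma, tau) ->
      forall h g : T -> R, Lr0 P r h -> Lr0 P r g ->
        (\forall x \ae P, h x - h (tau x) = g x - g (sigma x)) ->
        \forall x \ae P, h x - h (tau x) = 0].
Proof.
move=> /standard_lebesgue_coding[c cod] r1.
exists (generic_pairs c : set (maps P * maps P)); split.
- exact: generic_pairs_Gdelta.
- exact: generic_pairs_dense.
move=> sigma tau st h g [hr _] [gr _].
have L1 k : k \in Lfun P r -> P.-integrable setT (EFin \o k).
  move=> kr; apply/Lfun1_integrable.
  by apply: (Lfun_subset (lexx 1%E) r1 _ r1 kr); rewrite fin_num_measure.
apply: (model_pairs_trivial cod) (L1 _ hr) (L1 _ gr).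
exact: generic_pairsP st.
Qed.
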